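(* For every $d\in\mathbb{N}$ let $X^{(d)}=(X^{(d)}_{\cdot,1},\dots,X^{(d)}_{\cdot,d})$ be a random vector in $\mathbb{R}^d$, let $X_1^{(d)},X_2^{(d)},\dots$ be independent copies of $X^{(d)}$, with components $X_i^{(d)}=(X_{i,1}^{(d)},\dots,X_{i,d}^{(d)})$, and let $S_0^{(d)}:=0$, $S_k^{(d)}:=X_1^{(d)}+\dots+X_k^{(d)}$ for $k\in\mathbb{N}$. Assume: (a) $\mathbb{E}X^{(d)}=0$ and $\mathbb{E}\|X^{(d)}\|^2=1$ for all $d\in\mathbb{N}$; (b) $\mathbb{E}[X_{i,j}^{(d)}X_{i,k}^{(d)}]=0$ for all $d\in\mathbb{N}$, $i\in\mathbb{N}$ and $j,k\in\{1,\dots,d\}$ with $j\ne k$; (c) $\lim_{A\to\infty}\sup_{d\in\mathbb{N}}\mathbb{E}\big[\|X^{(d)}\|^2\mathbf{1}_{\{\|X^{(d)}\|^2>A\}}\big]=0$; (d) $\lim_{d\to\infty}\max_{k\in\{1,\dots,d\}}\mathbb{E}(X_{1,k}^{(d)})^2=0$. Let $n=n(d)$ be an arbitrary sequence of positive integers such that $n(d)\to\infty$ as $d\to\infty$. Let $\mathbb{M}_d$ be the random finite metric space consisting of the points $0,S_1^{(d)}/\sqrt n,\dots,S_n^{(d)}/\sqrt n$ endowed with the metric induced by the Euclidean metric on $\mathbb{R}^d$, and let $\mathbb{W}$ be the Wiener spiral. Then $\mathbb{M}_d$ converges in probability to $\mathbb{W}$ in the Gromov-Hausdorff space, that is, for every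 $\varepsilon>0$, $$\lim_{d\to\infty}\mathbb{P}[d_{GH}(\mathbb{M}_d,\mathbb{W})>\varepsilon]=0.$$
   Context: $\|\cdot\|$ is the Euclidean norm. The Wiener spiral $\mathbb{W}$ is the set $\{\mathbf{1}_{[0,t]}:0\le t\le1\}\subset L^2[0,1]$ with the induced $L^2$-metric; as a metric space it is (isometric to) the interval $[0,1]$ with the metric $(s,t)\mapsto\sqrt{|t-s|}$. The Gromov-Hausdorff distance $d_{GH}(E_1,E_2)$ between compact metric spaces $E_1,E_2$ is the infimum of $d_H(\varphi_1(E_1),\varphi_2(E_2))$ over all metric spaces $(M,\rho)$ and all isometric embeddings $\varphi_1:E_1\to M$, $\varphi_2:E_2\to M$, where $d_H(A,B)=\inf\{r>0:A\subset U_r(B),\,B\subset U_r(A)\}$ is the Hausdorff distance and $U_r(A)=\{m\in M:\rho(A,m)<r\}$. *)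

(* Defs.v *)
From HB Require Import structures.
From mathcomp Require Import all_boot all_order all_algebra.
From mathcomp Require Import finmap.
From mathcomp Require Import all_classical all_reals all_analysis.

Set Implicit Arguments.
Unset Strict Implicit.
Unset Printing Implicit Defensive.

Import Order.TTheory GRing.Theory Num.Theory.
Import numFieldNormedType.Exports.

Local Open Scope classical_set_scope.
Local Open Scope ring_scope.

Section Euclidean.
Context {R : realType} {d : nat}.
Implicit Types u v : d.-tuple R.

(* The library norm on ['rV[R]_d] is the sup norm, whence this definition. *)
Definition eucl_norm u : R := Num.sqrt (\sum_(j < d) tnth u j ^+ 2).

Definition eucl_dist u v : R :=
  eucl_norm [tuple tnth u j - tnth v j | j < d].

End Euclidean.

Section GromovHausdorff.
Context {R : realType}.
Local Open Scope ereal_scope.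

(* Distances are extended reals, so that an infimum over the empty set is
   [+oo] rather than a junk value. *)

Definition dist_to_set (M : metricType R) (A : set M) (m : M) : \bar R :=
  ereal_inf [set (mdist a m)%:E | a in A].

Definition open_enlargement (M : metricType R) (r : R) (A : set M) : set M :=
  [set m | dist_to_set A m < r%:E].

Definition hausdorff_dist (M : metricType R) (A B : set M) : \bar R :=
  ereal_inf [set r%:E | r in [set r : R |
    [/\ (0 < r)%R, A `<=` open_enlargement r B
      & B `<=` open_enlargement r A]]].

(* A metric space is given by a subset [E] of an ambient type and a function
   [rho] that is a metric on [E]; its values outside [E] are irrelevant. *)

Definition isometric_embedding (T : Type) (rho : T -> T -> R) (E : set T)
    (M : metricType R) (phi : T -> M) : Prop :=
  forall x y, E x -> E y -> mdist (phi x) (phi y) = rho x y.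

Definition gromov_hausdorff_dist
    (T1 : Type) (rho1 : T1 -> T1 -> R) (E1 : set T1)
    (T2 : Type) (rho2 : T2 -> T2 -> R) (E2 : set T2) : \bar R :=
  ereal_inf [set h | exists (M : metricType R) (phi1 : T1 -> M) (phi2 : T2 -> M),
    [/\ isometric_embedding rho1 E1 phi1, isometric_embedding rho2 E2 phi2
      & h = hausdorff_dist (phi1 @` E1) (phi2 @` E2)]].

End GromovHausdorff.

Section WienerSpiral.
Context (R : realType).

Definition lebesgue01 : {measure set (measurableTypeR R) -> \bar R} :=
  mrestr (@lebesgue_measure R) (measurable_itv `[0%R : R, 1%R]).

Definition L2_dist (f g : R -> R) : R :=
  fine ('N[lebesgue01]_2%:E[EFin \o (f \- g)]).

(* The elements are the actual functions rather than their classes modulo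
   almost everywhere equality: two distinct ones are at positive
   [L2_dist]. *)
Definition wiener_spiral : set (R -> R) :=
  [set \1_(`[0, t] : set R) | t in `[0, 1] : set R].

End WienerSpiral.
Arguments wiener_spiral {R}.
Arguments L2_dist {R}.

Section Probability.
Context {R : realType} {disp : measure_display} {Omega : measurableType disp}.
Variable P : probability Omega R.

Definition mutually_independent {disp' : measure_display}
    {T : measurableType disp'} (Y : nat -> {RV P >-> T}) : Prop :=
  forall (J : {fset nat}) (B : nat -> set T), (forall i, measurable (B i)) ->
    P (\bigcap_(i in [set` J]) (Y i @^-1` B i)) =
    (\prod_(i <- J) P (Y i @^-1` B i))%E.

Definition independent_copies {disp' : measure_display}
    {T : measurableType disp'} (X : {RV P >-> T}) (Y : nat -> {RV P >-> T}) :
    Prop :=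
  mutually_independent Y /\
  forall i B, measurable B -> distribution P (Y i) B = distribution P X B.

End Probability.

Section RandomWalk.
Context {R : realType} {T : Type} {d : nat}.

(* The increments are numbered from 0: [Y i] is the (i+1)-st step. *)
Definition walk (Y : nat -> T -> d.-tuple R) (k : nat) (w : T) : d.-tuple R :=
  [tuple \sum_(i < k) tnth (Y i w) j | j < d].

Definition walk_points (Y : nat -> T -> d.-tuple R) (n : nat) (w : T) :
    set (d.-tuple R) :=
  [set [tuple tnth (walk Y k w) j / Num.sqrt n%:R | j < d]
     | k in [set k | (k <= n)%N]].

End RandomWalk.

(* Main.v *)
(* By gluing along a correspondence, d_GH(walk, spiral) < r holds iff some
   correspondence between the walk and [0, 1] with the metric sqrt|s - t| has
   distortion 2s with s < r.  This condition is open in the distance matrix of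
   the walk, which makes the event {d_GH > eps} measurable.  It holds as soon as
   |S_l - S_g|^2 is close to l - g, uniformly in l, for finitely many bases g.
   Expanding |S_l|^2 - l into a martingale with truncated increments plus the
   tails of |X_i|^2, the martingale is stopped on leaving [-lam, lam], so that
   Chebyshev's inequality for its final value is a maximal inequality; its
   variance is at most n (8 sigma n + 2 A), where sigma bounds the coordinate
   variances and A is the truncation level, because the covariance is
   diagonal. *)
Require Import Defs.
From HB Require Import structures.
From mathcomp Require Import all_boot all_order all_algebra.
From mathcomp Require Import finmap lra ring zify.
From mathcomp Require Import all_classical all_reals all_analysis.
From mathcomp Require Import measurable_realfun.
Import Order.TTheory GRing.Theory Num.Theory.
Import numFieldNormedType.Exports.
Local Open Scope classical_set_scope.
Local Open Scope ring_scope.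

(** Only second moments are assumed, so [|X|^2] need not have a variance; truncation makes
    Chebyshev's inequality applicable, and uniform integrability makes the mean [e] of the removed
    tails small uniformly in d. The tails are nonnegative, so their partial sums are largest at the
    final time and Markov's inequality there covers all times. The cross term 2<S_k, X> contributes
    variance of order sigma k, hence sigma n^2 in total. This is negligible against n^2 only because
    sigma tends to 0. Conditional expectations are avoided: the walk and the stopped martingale form
    one Markov chain driven by independent inputs, so moments reduce to iterated integrals. A single
    base controls only distances to that base, and a union bound over all n bases would be too
    costly, since the deviation probability has no rate. The bases are therefore spaced by about
    n/m, with m fixed before d grows. Points between bases are handled by the triangle inequality,
    at a cost of order sqrt(1/m) after scaling. *)

Definition metric_axioms (R : realType) (T : Type) (rho : T -> T -> R) : Prop :=
  [/\ forall x, rho x x = 0, forall x y, rho x y = 0 -> x = y,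
      forall x y, rho x y = rho y x &
      forall y x z, rho x z <= rho x y + rho y z].

Lemma metric_axioms_ge0 (R : realType) (T : Type) (rho : T -> T -> R) :
  metric_axioms _ _ rho -> forall x y, 0 <= rho x y.
Proof.
case=> h0 _ hs ht x y; have := ht y x x; rewrite h0 (hs y x); lra.
Qed.

(** * Gluing two metric spaces along a correspondence *)

Section Gluing.
Context (R : realType) (T1 T2 : choiceType) (I : Type).
Variables (r1 : T1 -> T1 -> R) (r2 : T2 -> T2 -> R).
Variables (x : I -> T1) (y : I -> T2) (i0 : I) (delta : R).
Hypothesis m1 : metric_axioms _ _ r1.
Hypothesis m2 : metric_axioms _ _ r2.
Hypothesis delta_gt0 : 0 < delta.
Hypothesis distortion :
  forall i j, `|r1 (x i) (x j) - r2 (y i) (y j)| <= 2 * delta.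

(** Shortest passage when a bridge of length [delta] is laid between [x i] and [y i] for every
    [i]. *)
Definition glue_cross (u : T1) (v : T2) : R :=
  inf [set r1 u (x i) + delta + r2 (y i) v | i in [set: I]].

Let has_inf_cross u v :
  has_inf [set r1 u (x i) + delta + r2 (y i) v | i in [set: I]].
Proof.
split; first by exists (r1 u (x i0) + delta + r2 (y i0) v); exists i0.
exists 0 => _ [i _ <-].
have := metric_axioms_ge0 _ _ _ m1 u (x i).
have := metric_axioms_ge0 _ _ _ m2 (y i) v; have := delta_gt0; lra.
Qed.

Lemma glue_cross_le u v i : glue_cross u v <= r1 u (x i) + delta + r2 (y i) v.
Proof. by apply: ge_inf; [exact: (has_inf_cross u v).2|exists i]. Qed.

Lemma le_glue_cross u v c :
  (forall i, c <= r1 u (x i) + delta + r2 (y i) v) -> c <= glue_cross u v.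
Proof.
move=> h; apply: lb_le_inf; first exact: (has_inf_cross u v).1.
by move=> _ [i _ <-].
Qed.

Lemma le_glue_crossD c u v w z :
  (forall i j, c <= (r1 u (x i) + delta + r2 (y i) v) +
                    (r1 w (x j) + delta + r2 (y j) z)) ->
  c <= glue_cross u v + glue_cross w z.
Proof.
move=> h; rewrite -lerBlDr; apply: le_glue_cross => i.
rewrite lerBlDr addrC -lerBlDr; apply: le_glue_cross => j.
by rewrite lerBlDr addrC.
Qed.

Definition glue_dist (a b : T1 + T2) : R :=
  match a, b with
  | inl u, inl v => r1 u v
  | inr u, inr v => r2 u v
  | inl u, inr v => glue_cross u v
  | inr u, inl v => glue_cross v u
  end.

Lemma glue_cross_gt0 u v : 0 < glue_cross u v.
Proof.
apply: lt_le_trans delta_gt0 _; apply: le_glue_cross => i.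
have := metric_axioms_ge0 _ _ _ m1 u (x i).
have := metric_axioms_ge0 _ _ _ m2 (y i) v; have := delta_gt0; lra.
Qed.

(** A detour that crosses twice pays for two bridges, [2 * delta] in total, and by the distortion
    bound it cannot undercut the original distance. Positivity of [delta] keeps the two pieces
    apart, so that distinct points have positive distance. *)
Lemma glue_dist_metric : metric_axioms _ _ glue_dist.
Proof.
have [z1 p1 s1 t1] := m1; have [z2 p2 s2 t2] := m2.
split.
- by case.
- case=> u [] v //= h; first by rewrite (p1 _ _ h).
  + by have := glue_cross_gt0 u v; rewrite h ltxx.
  + by have := glue_cross_gt0 v u; rewrite h ltxx.
  + by rewrite (p2 _ _ h).
- by case=> u [] v //=.
- have D i j := distortion i j.
  case=> v [] u [] w //=.
  + rewrite -lerBlDl; apply: le_glue_cross => i.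
    have := glue_cross_le u w i; have := t1 v u (x i); lra.
  + rewrite -lerBlDr; apply: le_glue_cross => i.
    have := glue_cross_le w u i; have := t1 v w (x i).
    by rewrite (s1 v w); lra.
  + apply: le_glue_crossD => i j.
    have := t2 (y i) u w; have := t2 (y j) (y i) w.
    have := t1 v (x i) (x j); rewrite (s1 (x i) v) (s2 u (y i)).
    have := D i j; rewrite ler_distl => /andP[]; lra.
  + apply: le_glue_crossD => i j.
    have := t1 (x i) u w; have := t1 (x j) (x i) w.
    have := t2 v (y i) (y j); rewrite (s1 w (x j)) (s2 v (y j)).
    have := D i j; rewrite ler_distl => /andP[]; lra.
  + rewrite -lerBlDr; apply: le_glue_cross => i.
    have := glue_cross_le u w i; have := t2 v (y i) w; lra.
  + rewrite -lerBlDl; apply: le_glue_cross => i.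
    have := glue_cross_le w u i; have := t2 v (y i) u; rewrite (s2 v u); lra.
Qed.

Lemma gluing : exists (M : metricType R) (f1 : T1 -> M) (f2 : T2 -> M),
  [/\ forall u v, mdist (f1 u) (f1 v) = r1 u v,
      forall u v, mdist (f2 u) (f2 v) = r2 u v &
      forall i, mdist (f1 (x i)) (f2 (y i)) <= delta].
Proof.
have [h0 hp hs ht] := glue_dist_metric.
pose mM := @isMetric.Build R (T1 + T2)%type glue_dist h0 hp hs ht.
pose M : metricType R := HB.pack (T1 + T2)%type mM.
exists M, inl, inr; split => // i.
change (glue_cross (x i) (y i) <= delta).
apply: le_trans (glue_cross_le _ _ i) _.
by case: m1 m2 => -> _ _ _ [-> _ _ _]; lra.
Qed.

End Gluing.

(** * Euclidean and square-root inequalities *)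

Lemma sum_sqr_eq0 (R : realDomainType) d (a : 'I_d -> R) :
  \sum_j a j ^+ 2 = 0 -> forall j, a j = 0.
Proof.
move=> /eqP; rewrite psumr_eq0 => [/allP h j|j _]; last exact: sqr_ge0.
by have := h j (mem_index_enum j); rewrite sqrf_eq0 => /eqP.
Qed.

(** The sum of the squares of [B * a j - C * b j] is nonnegative and equals B times the wanted
    difference; [B = 0] forces [b] to vanish. *)
Lemma cauchy_schwarz_sum (R : realFieldType) d (a b : 'I_d -> R) :
  (\sum_j a j * b j) ^+ 2 <= (\sum_j a j ^+ 2) * (\sum_j b j ^+ 2).
Proof.
set C := \sum_j _; set A := \sum_j _; set B := \sum_j _.
have B0 : 0 <= B by apply: sumr_ge0 => j _; exact: sqr_ge0.
have [Bz|Bn] := eqVneq B 0.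
  rewrite /C big1 ?expr0n ?Bz ?mulr0// => j _.
  by rewrite (sum_sqr_eq0 _ _ _ Bz) mulr0.
have : 0 <= \sum_j (B * a j - C * b j) ^+ 2.
  by apply: sumr_ge0 => j _; exact: sqr_ge0.
have -> : \sum_j (B * a j - C * b j) ^+ 2 = B * (A * B - C ^+ 2).
  transitivity (\sum_j (B ^+ 2 * (a j ^+ 2) - (2 * B * C) * (a j * b j) +
      C ^+ 2 * (b j ^+ 2))); first by apply: eq_bigr => j _; ring.
  by rewrite big_split sumrB -!mulr_sumr/= -/A -/B -/C; ring.
by rewrite pmulr_rge0 ?subr_ge0// lt_neqAle eq_sym Bn.
Qed.

Lemma sqrt_sum_sqr_triangle (R : rcfType) d (a b : 'I_d -> R) :
  Num.sqrt (\sum_j (a j + b j) ^+ 2) <=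
  Num.sqrt (\sum_j a j ^+ 2) + Num.sqrt (\sum_j b j ^+ 2).
Proof.
set A := \sum_j a j ^+ 2; set B := \sum_j b j ^+ 2.
have A0 : 0 <= A by apply: sumr_ge0 => j _; exact: sqr_ge0.
have B0 : 0 <= B by apply: sumr_ge0 => j _; exact: sqr_ge0.
rewrite -[leRHS]ger0_norm ?addr_ge0 ?sqrtr_ge0//.
rewrite -sqrtr_sqr ler_wsqrtr// sqrrD !sqr_sqrtr//.
have -> : \sum_j (a j + b j) ^+ 2 = A + (\sum_j a j * b j) *+ 2 + B.
  rewrite -sumrMnl -!big_split/=; apply: eq_bigr => j _; ring.
rewrite lerD2r lerD2l lerMn2r -sqrtrM//=.
apply: le_trans (ler_norm _) _.
by rewrite -sqrtr_sqr ler_wsqrtr// cauchy_schwarz_sum.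
Qed.

Lemma sqrtD_le (R : rcfType) (a b : R) : 0 <= a -> 0 <= b ->
  Num.sqrt (a + b) <= Num.sqrt a + Num.sqrt b.
Proof.
move=> a0 b0; rewrite -[leRHS]ger0_norm ?addr_ge0 ?sqrtr_ge0//.
rewrite -sqrtr_sqr ler_wsqrtr// sqrrD !sqr_sqrtr// lerD2r lerDl.
by rewrite mulrn_wge0// mulr_ge0// sqrtr_ge0.
Qed.

(** This turns a deviation of squared norms into a deviation of distances. *)
Lemma dist_sqrt_le (R : rcfType) (a b : R) : 0 <= a -> 0 <= b ->
  `|Num.sqrt a - Num.sqrt b| <= Num.sqrt `|a - b|.
Proof.
wlog ab : a b / b <= a => [wh a0 b0|a0 b0].
  have [ba|/ltW ab] := leP b a; first exact: wh.
  by rewrite distrC (distrC a); exact: wh.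
rewrite !ger0_norm ?subr_ge0 ?ler_wsqrtr// lerBlDr.
by rewrite -{1}(subrK b a) sqrtD_le// subr_ge0.
Qed.

Section EuclideanMetric.
Context {R : realType} {d : nat}.
Implicit Types u v : d.-tuple R.

Lemma eucl_norm_ge0 u : 0 <= eucl_norm u.
Proof. exact: sqrtr_ge0. Qed.

Lemma eucl_norm2E u : eucl_norm u ^+ 2 = \sum_(j < d) tnth u j ^+ 2.
Proof. by rewrite sqr_sqrtr// sumr_ge0// => j _; exact: sqr_ge0. Qed.

Lemma eucl_distE u v :
  eucl_dist u v = Num.sqrt (\sum_(j < d) (tnth u j - tnth v j) ^+ 2).
Proof.
rewrite /eucl_dist /eucl_norm; congr Num.sqrt.
by apply: eq_bigr => j _; rewrite tnth_mktuple.
Qed.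

Lemma eucl_dist_metric : metric_axioms R (d.-tuple R) eucl_dist.
Proof.
split=> [u|u v|u v|v u w]; rewrite !eucl_distE.
- by rewrite big1 ?sqrtr0// => j _; rewrite subrr expr0n.
- move/eqP; rewrite sqrtr_eq0 => le0; apply: eq_from_tnth => j.
  apply/eqP; rewrite -subr_eq0; apply/eqP.
  apply: (sum_sqr_eq0 _ _ (fun j => tnth u j - tnth v j)); apply/eqP.
  by rewrite eq_le le0 sumr_ge0// => k _; exact: sqr_ge0.
- by congr Num.sqrt; apply: eq_bigr => j _; rewrite -sqrrN opprB.
- apply: le_trans _ (sqrt_sum_sqr_triangle _ _ _ _); rewrite ler_wsqrtr//.
  by under [leRHS]eq_bigr do rewrite addrA subrK.
Qed.

End EuclideanMetric.

(** * The Wiener spiral as an interval with the square-root metric *)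

Definition root_dist {R : rcfType} (s t : R) : R := Num.sqrt `|s - t|.

Lemma root_dist_metric (R : realType) : metric_axioms R R root_dist.
Proof.
rewrite /root_dist; split=> [s|s t|s t|t s u].
- by rewrite subrr normr0 sqrtr0.
- move/eqP; rewrite sqrtr_eq0 normr_le0 subr_eq0; exact/eqP.
- by rewrite distrC.
- apply: le_trans _ (sqrtD_le _ _ _ _ _) => //; rewrite ler_wsqrtr//.
  by rewrite -[s - u](subrKA t) ler_normD.
Qed.

(** For [s <= t] the squared difference of the two indicators is the indicator of []s, t]], of
    measure [t - s]. *)
Lemma L2_dist_indic {R : realType} (s t : R) : 0 <= s <= 1 -> 0 <= t <= 1 ->
  L2_dist \1_(`[0, s] : set R) \1_(`[0, t] : set R) = root_dist s t.
Proof.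
wlog st : s t / s <= t => [wh hs ht|/andP[s0 s1] /andP[t0 t1]].
  have [le_st|/ltW le_ts] := leP s t; first exact: wh.
  rewrite /root_dist distrC -/(root_dist t s) -wh//.
  rewrite /L2_dist unlock; congr (fine (poweR _ _)).
  apply: eq_integral => u _ /=; by rewrite distrC.
rewrite /L2_dist unlock /root_dist.
have -> : (\int[lebesgue01 R]_x (`|(EFin \o ((\1_(`[0%R, s]%classic) : R -> R) \-
    \1_(`[0%R, t]%classic))%R) x| `^ 2))%E = (t - s)%:E.
  transitivity (\int[lebesgue01 R]_x (\1_(`]s, t]%classic : set R) x)%:E)%E.
    apply: eq_integral => u _ /=.
    rewrite !indicE !mem_setE !in_itv/= powR_mulrn ?normr_ge0//.
    congr EFin; case: (leP 0 u) => u0; case: (leP u s) => us;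
      case: (leP u t) => ut /=;
      rewrite ?subrr ?subr0 ?sub0r ?normrN ?normr0 ?normr1 ?expr0n ?expr1n//; lra.
  rewrite integral_indic//= /lebesgue01 /mrestr setIT.
  rewrite setIidl; last first.
    by move=> u; rewrite /= !in_itv/= => /andP[su ut]; apply/andP; split; lra.
  rewrite lebesgue_measure_itv/= lte_fin EFinB.
  by case: ltP => // ts; rewrite (_ : t = s) ?subee//; apply/eqP; rewrite eq_le ts st.
rewrite poweR_EFin/= powR12_sqrt ?subr_ge0// distrC.
by rewrite ger0_norm ?subr_ge0.
Qed.

(* [C] is a correspondence of distortion at most [c] between the indices 0..N,
   at mutual distances [D], and the Wiener spiral, parametrized by [0, 1]. *)
Definition near_spiral {R : realType} (N : nat) (D : nat -> nat -> R) (c : R) :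
    Prop :=
  exists C : nat -> R -> Prop,
  [/\ forall k t, C k t -> (k <= N)%N /\ 0 <= t <= 1,
      forall k, (k <= N)%N -> exists t, C k t,
      forall t, 0 <= t <= 1 -> exists k, C k t &
      forall k t l u, C k t -> C l u -> `|D k l - root_dist t u| <= c].

(** * Correspondences and the Gromov-Hausdorff distance *)

Section NearSpiralGH.
Context {R : realType} {d : nat}.
Variables (N : nat) (p : nat -> d.-tuple R).
Let E := [set p k | k in [set k | (k <= N)%N]].
Let D k l := eucl_dist (p k) (p l).

Lemma dist_to_set_lt (M : metricType R) (A : set M) (m : M) (r : R) :
  (dist_to_set A m < r%:E)%E <-> exists2 a, A a & mdist a m < r.
Proof.
rewrite /dist_to_set; split=> [/ereal_inf_lt[_ [a Aa <-]]|[a Aa h]].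
  by rewrite lte_fin; exists a.
apply: (@le_lt_trans _ _ (mdist a m)%:E); last by rewrite lte_fin.
by apply: ereal_inf_lbound; exists a.
Qed.

Lemma near_spiral_gh_lt (s r : R) : 0 < s -> s < r ->
  near_spiral N D (2 * s) ->
  (gromov_hausdorff_dist eucl_dist E L2_dist wiener_spiral < r%:E)%E.
Proof.
move=> s0 sr [C [C01 CN CI CD]].
(* The bridges are indexed by the graph of [C]. The glued spaces are all of [d.-tuple R] and all of
   [R], where the metric axioms hold without side conditions. *)
pose I := {q : nat * R | C q.1 q.2}.
have [t0 Ct0] := CN 0%N (leq0n _).
pose i0 : I := exist _ (0%N, t0) Ct0.
have [|M [f1 [f2 [h1 h2 h12]]]] := gluing _ _ _ _ _ _
  (fun i : I => p (sval i).1) (fun i : I => (sval i).2) i0 _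
  eucl_dist_metric (root_dist_metric R) s0.
  by move=> [[k t] /= Ck] [[l u] /= Cl]; exact: CD.
(* [par] recovers the parameter of an element of the spiral; it is unique because [root_dist]
   separates points. The value 0 is a default off the spiral. *)
pose par (f : R -> R) : R := xget 0 [set t | 0 <= t <= 1 /\ f = \1_(`[0, t])].
have parP f : wiener_spiral f -> 0 <= par f <= 1 /\ f = \1_(`[0, par f]).
  move=> [t /= t01 ft]; rewrite /par; case: xgetP => [_ -> //|/(_ t)[]].
  by split=> //; rewrite in_itv in t01.
have par_indic t : 0 <= t <= 1 -> par \1_(`[0, t]) = t.
  move=> t01; have [] : wiener_spiral (\1_(`[0, t]) : R -> R).
    by exists t => //=; rewrite in_itv.
  move=> u u01 eu.
  have [v01 ev] : 0 <= par \1_(`[0, t]) <= 1 /\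
      (\1_(`[0, t]) : R -> R) = \1_(`[0, par \1_(`[0, t])]).
    by apply: parP; exists u.
  have [_ rp _ _] := root_dist_metric R; apply: rp.
  by rewrite -L2_dist_indic// -ev L2_dist_indic//; case: (root_dist_metric R).
(* Bridges have length at most [s], enlargements are open, and the final bound by [r] is strict: a
   radius strictly between [s] and [r] serves both purposes. *)
apply: (@le_lt_trans _ _ (((s + r) / 2)%:E)); last by rewrite lte_fin; lra.
apply: (@le_trans _ _ (hausdorff_dist (f1 @` E) ((f2 \o par) @` wiener_spiral))).
  apply: ereal_inf_lbound; exists M, f1, (f2 \o par); split => //.
  move=> f g /parP[f01 ef] /parP[g01 eg] /=; rewrite h2.
  by rewrite [in RHS]ef [in RHS]eg L2_dist_indic.
apply: ereal_inf_lbound; exists ((s + r) / 2) => //=; split; first lra.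
- move=> _ [_ [k /= kN <-] <-]; apply/dist_to_set_lt.
  have [t Ckt] := CN _ kN; have [_ t01] := C01 _ _ Ckt.
  exists (f2 t).
    by exists \1_(`[0, t]); rewrite /= ?par_indic//; exists t; rewrite //= in_itv.
  rewrite metric_sym; have /= := h12 (exist _ (k, t) Ckt); lra.
- move=> _ [f wf <-]; apply/dist_to_set_lt => /=.
  have [t01 _] := parP _ wf; have [k Ckt] := CI _ t01.
  exists (f1 (p k)); first by exists (p k) => //; exists k => //=; case: (C01 _ _ Ckt).
  by have /= := h12 (exist _ (k, par f) Ckt); lra.
Qed.

(** The pairs whose images lie closer than [s] in the common space form the correspondence;
    replacing both endpoints of a distance costs less than [2 * s]. *)
Lemma gh_lt_near_spiral (r : R) :
  (gromov_hausdorff_dist eucl_dist E L2_dist wiener_spiral < r%:E)%E ->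
  exists s, [/\ 0 < s, s < r & near_spiral N D (2 * s)].
Proof.
move=> /ereal_inf_lt[_ [M [f1 [f2 [h1 h2 ->]]]]].
move=> /ereal_inf_lt[_ [s /= [s0 A B] <-]]; rewrite lte_fin => sr.
exists s; split=> //.
have wien t : 0 <= t <= 1 -> wiener_spiral (\1_(`[0, t]) : R -> R).
  by move=> t01; exists t; rewrite //= in_itv.
have Ep k : (k <= N)%N -> E (p k) by move=> kN; exists k.
exists (fun k t => [/\ (k <= N)%N, 0 <= t <= 1 &
                    mdist (f1 (p k)) (f2 \1_(`[0, t])) < s]); split.
- by move=> k t [].
- move=> k kN; have /dist_to_set_lt[_ [_ [t /= t01 <-] <-] h] :=
    A _ (imageP f1 (Ep _ kN)).
  by exists t; split; rewrite // 1?metric_sym//; rewrite in_itv in t01.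
- move=> t t01; have /dist_to_set_lt[_ [_ [k kN <-] <-] h] :=
    B _ (imageP f2 (wien _ t01)).
  by exists k; split.
- move=> k t l u [kN t01 hk] [lN u01 hl].
  rewrite /D -(h1 _ _ (Ep _ kN) (Ep _ lN)) -L2_dist_indic//.
  rewrite -(h2 _ _ (wien _ t01) (wien _ u01)).
  have := metric_triangle (f1 (p k)) (f2 \1_(`[0, t])) (f1 (p l)).
  have := metric_triangle (f2 \1_(`[0, t])) (f2 \1_(`[0, u])) (f1 (p l)).
  have := metric_triangle (f2 \1_(`[0, t])) (f1 (p k)) (f2 \1_(`[0, u])).
  have := metric_triangle (f1 (p k)) (f1 (p l)) (f2 \1_(`[0, u])).
  rewrite (metric_sym (f2 \1_(`[0, u])) (f1 (p l))).
  rewrite (metric_sym (f2 \1_(`[0, t])) (f1 (p k))).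
  move: hk hl; set a := mdist _ _; set b := mdist _ _; set c := mdist _ _;
  set e := mdist _ _; set g := mdist _ _; rewrite ler_distl; lra.
Qed.

End NearSpiralGH.

Lemma near_spiral_perturb (R : realType) (N : nat) (D D' : nat -> nat -> R)
    (c q : R) :
  (forall k l, (k <= N)%N -> (l <= N)%N -> `|D' k l - D k l| <= q) ->
  near_spiral N D c -> near_spiral N D' (c + q).
Proof.
move=> DD' [C [C01 CN CI CD]]; exists C; split=> // k t l u Ck Cl.
have [kN _] := C01 _ _ Ck; have [lN _] := C01 _ _ Cl.
have := CD _ _ _ _ Ck Cl; have := DD' k l kN lN.
by rewrite !ler_distl; lra.
Qed.

Lemma near_spiral_le (R : realType) (N : nat) (D : nat -> nat -> R) (c c' : R) :
  c <= c' -> near_spiral N D c -> near_spiral N D c'.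
Proof.
move=> cc' [C [C01 CN CI CD]]; exists C; split=> // k t l u Ck Cl.
exact: le_trans (CD _ _ _ _ Ck Cl) cc'.
Qed.

(** * Measurability of the Gromov-Hausdorff event *)

Section Measurability.
Context {R : realType} {disp : measure_display} {T : measurableType disp}.

Lemma measurable_set_ltr (f g : T -> R) :
  measurable_fun setT f -> measurable_fun setT g ->
  measurable [set w | f w < g w].
Proof.
move=> mf mg; rewrite -[X in measurable X]setTI.
exact: (measurable_fun_ltr mf mg measurableT (_ : measurable [set true])).
Qed.

Lemma measurable_sqrtr (f : T -> R) :
  measurable_fun setT f -> measurable_fun setT (fun w => Num.sqrt (f w)).
Proof.
move=> mf; apply: (@measurableT_comp _ _ _ _ _ _ (@Num.sqrt R)) => //.
by apply: continuous_measurable_fun => x; exact: sqrt_continuous.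
Qed.

(** Correspondences range over an uncountable family, so they are not enumerated. Instead the event
    is a countable union of boxes around rational matrices; whether a box is admissible, [good],
    does not depend on [w]. *)
Lemma measurable_near_spiral (N : nat) (D : T -> nat -> nat -> R) (r : R) :
  (forall k l, measurable_fun setT (fun w => D w k l)) ->
  measurable [set w | exists s, [/\ 0 < s, s < r & near_spiral N (D w) (2 * s)]].
Proof.
move=> mD.
(* Out-of-range values of [inord] do not matter, since a correspondence only relates indices up to
   [N]. *)
pose ext (Q : {ffun 'I_N.+1 * 'I_N.+1 -> rat}) k l : R :=
  ratr (Q (inord k, inord l)).
pose near (x : {ffun 'I_N.+1 * 'I_N.+1 -> rat} * rat) : set T :=
  \bigcap_(ij in [set: 'I_N.+1 * 'I_N.+1])
    [set w | `|D w ij.1 ij.2 - ratr (x.1 ij)| < ratr x.2].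
pose good (x : {ffun 'I_N.+1 * 'I_N.+1 -> rat} * rat) : Prop :=
  exists s, [/\ 0 < s, s < r & near_spiral N (ext x.1) (2 * s - ratr x.2)].
rewrite [X in measurable X](_ : _ =
  \bigcup_x (if `[< good x >] then near x else set0)).
  apply: countable_bigcupT_measurable => // x; case: asboolP => _ //.
  apply: fin_bigcap_measurable => // ij _; apply: measurable_set_ltr => //.
  apply: measurableT_comp => //; apply: measurable_funB => //; exact: mD.
apply/seteqP; split=> w /=.
- move=> [s [s0 sr Ds]].
  have [q /=] : exists q, ratr q \in `]0, (r - s) / 2[.
    by apply: rat_in_itvoo; lra.
  rewrite in_itv/= => /andP[q0 qrs].
  have QE (ij : 'I_N.+1 * 'I_N.+1) :
      exists a : rat, `|D w ij.1 ij.2 - ratr a| < ratr q.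
    have [a /=] : exists a, ratr a \in `]D w ij.1 ij.2 - ratr q, D w ij.1 ij.2 + ratr q[.
      by apply: rat_in_itvoo; lra.
    by rewrite in_itv/= -ltr_distlC; exists a.
  have [Q HQ] := choice QE.
  exists ([ffun ij => Q ij], q) => //; case: asboolP => [_|[]].
    by move=> ij _ /=; rewrite ffunE.
  (* Passing from [D w] to the rational matrix costs [ratr q], and [good] demands another [ratr q]
     as margin for the way back; both fit because [ratr q < (r - s) / 2]. *)
  exists ((s + r) / 2); split; try lra.
  apply: near_spiral_le (near_spiral_perturb _ _ _ _ _ (ratr q) _ Ds) => /=.
    by lra.
  move=> k l kN lN; rewrite /ext ffunE distrC.
  by have := HQ (inord k, inord l); rewrite /= !inordK//; exact: ltW.
- move=> [[Q q] _]; case: asboolP => // -[s /= [s0 sr Qs]] nw.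
  exists s; split => //.
  have -> : 2 * s = 2 * s - ratr q + ratr q by rewrite subrK.
  apply: near_spiral_perturb Qs => k l kN lN.
  by have := nw (inord k, inord l) I; rewrite /= !inordK//; exact: ltW.
Qed.

End Measurability.

Section WalkMeasurability.
Context {R : realType} {disp : measure_display} {T : measurableType disp}.
Context {d : nat} (Y : nat -> T -> d.-tuple R).
Hypothesis mY : forall i, measurable_fun setT (Y i).

Lemma measurable_walk k j : measurable_fun setT (fun w => tnth (walk Y k w) j).
Proof.
under eq_fun do rewrite tnth_mktuple.
apply: measurable_sum => i.
exact: (measurableT_comp (measurable_tnth j) (mY i)).
Qed.

Lemma measurable_gh_gt (n : nat) (eps : R) :
  measurable [set w | (eps%:E < gromov_hausdorff_dist eucl_dist
    (walk_points Y n w) L2_dist wiener_spiral)%E].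
Proof.
pose p w k : d.-tuple R := [tuple tnth (walk Y k w) j / Num.sqrt n%:R | j < d].
pose G r := [set w | (gromov_hausdorff_dist eucl_dist
    (walk_points Y n w) L2_dist wiener_spiral < r%:E)%E].
have mG r : measurable (G r).
  rewrite [G r](_ : _ = [set w | exists s, [/\ 0 < s, s < r &
      near_spiral n (fun k l => eucl_dist (p w k) (p w l)) (2 * s)]]).
    apply: measurable_near_spiral => k l.
    under eq_fun do rewrite eucl_distE.
    apply: measurable_sqrtr; apply: measurable_sum => j.
    have pE w i : tnth (p w i) j = tnth (walk Y i w) j / Num.sqrt n%:R.
      exact: tnth_mktuple.
    under eq_fun do rewrite !pE.
    apply: measurable_funX; apply: measurable_funB;
      by apply: measurable_funM => //; exact: measurable_walk.
  apply/seteqP; split=> w; first exact: gh_lt_near_spiral.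
  by move=> [s [s0 sr]]; exact: near_spiral_gh_lt.
rewrite [X in measurable X](_ : _ = ~` \bigcap_m G (eps + m.+1%:R^-1)).
  by apply: measurableC; apply: bigcap_measurableType => k _; exact: mG.
apply/seteqP; split=> w /=.
- move=> lt_eps h.
  have : (gromov_hausdorff_dist eucl_dist
      (walk_points Y n w) L2_dist wiener_spiral <= eps%:E)%E.
    apply/lee_addgt0Pr => e e0.
    have [m _ hm] := near_infty_natSinv_lt (PosNum e0).
    apply: ltW; apply: lt_le_trans (h m I) _.
    by rewrite -EFinD lee_fin lerD2l ltW//; exact: (hm m (leqnn m)).
  by rewrite leNgt lt_eps.
- move=> h; rewrite ltNge; apply/negP => le_eps; apply: h => m _.
  by apply: le_lt_trans le_eps _; rewrite lte_fin ltrDl invr_gt0 ltr0n.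
Qed.

End WalkMeasurability.

(** * Independence and Markov chains driven by independent inputs *)

Section RectangleUniqueness.
Context {d1 d2 : measure_display} {S : measurableType d1} {T : measurableType d2}.
Context {R : realType}.
Local Open Scope ereal_scope.

Lemma rectangle_measure_unique (m1 m2 : {measure set (S * T) -> \bar R}) :
  m1 setT < +oo ->
  (forall A B, measurable A -> measurable B -> m1 (A `*` B) = m2 (A `*` B)) ->
  forall X, measurable X -> m1 X = m2 X.
Proof.
move=> m1oo m12 X mX.
pose C : set (set (S * T)) :=
  [set A `*` B | A in @measurable _ S & B in @measurable _ T].
apply: (measure_unique C (fun=> setT)) => //.
- exact: measurable_prod_measurableType.
- move=> _ _ [A1 mA1 [B1 mB1 <-]] [A2 mA2 [B2 mB2 <-]]; rewrite -setXI.
  by exists (A1 `&` A2); [exact: measurableI|exists (B1 `&` B2) => //; exact: measurableI].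
- by move=> _; exists setT => //; exists setT => //; rewrite setXTT.
- exact: bigcup_const.
- by move=> _ [A mA [B mB <-]]; exact: m12.
Qed.
End RectangleUniqueness.

Section MarkovChain.
Context {R : realType} {d0 d1 d2 : measure_display}.
Context {Omega : measurableType d0} {S : measurableType d1} {T : measurableType d2}.
Variable P : probability Omega R.
Local Open Scope ereal_scope.

(* Independence of the initial segments; unlike [mutually_independent] this
   form is visibly stable under shifts. *)
Definition independent_seq (Y : nat -> Omega -> T) : Prop :=
  forall m (B : nat -> set T), (forall i, measurable (B i)) ->
    P (\bigcap_(i in `I_m) (Y i @^-1` B i)) = \prod_(i < m) P (Y i @^-1` B i).

(** The first [g] constraints are taken to be [setT], so they contribute factors 1. *)
Lemma independent_seq_shift (Y : nat -> Omega -> T) (g : nat) :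
  independent_seq Y -> independent_seq (fun i => Y (g + i)%N).
Proof.
move=> iY m B mB.
have ltnNge' i : (g + i < g)%N = false by lia.
have := iY (g + m)%N (fun i => if (i < g)%N then setT else B (i - g)%N).
rewrite big_split_ord/= big1 => [|i _]; last first.
  by rewrite ltn_ord preimage_setT probability_setT.
rewrite mul1e => h.
transitivity (\prod_(i < m) P (Y (g + i)%N @^-1` (if (g + i < g)%N then setT else B (g + i - g)%N))).
  rewrite -h; last by move=> i; case: ifP.
  congr (P _); apply/seteqP; split=> w /= hw i /= im.
    case: ifPn => // ; rewrite -leqNgt => gi /=.
    by have := hw (i - g)%N; rewrite /= subnKC//; apply; rewrite /=; lia.
  by have := hw (g + i)%N; rewrite /= ltn_add2l ltnNge' addKn; exact.
by apply: eq_bigr => i _; rewrite ltnNge' addKn.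
Qed.

Variables (F : S * T -> S) (s0 : S) (Y : nat -> Omega -> T).
Hypothesis mF : measurable_fun setT F.
Hypothesis mY : forall i, measurable_fun setT (Y i).
Hypothesis iY : independent_seq Y.

Fixpoint chain k w : S := if k is k'.+1 then F (chain k' w, Y k' w) else s0.

Lemma measurable_chain k : measurable_fun setT (chain k).
Proof.
elim: k => [|k IH]/=; first exact: measurable_cst.
exact: (measurableT_comp mF (measurable_fun_pair IH (mY k))).
Qed.

Let mpre (f : Omega -> T) (B : set T) :
  measurable_fun setT f -> measurable B -> measurable (f @^-1` B).
Proof. by move=> mf mB; rewrite -[X in measurable X]setTI; exact: mf. Qed.

Let mfut k m (B : nat -> set T) : (forall i, measurable (B i)) ->
  measurable (\bigcap_(i in `I_m) (Y (k + i)%N @^-1` B i)).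
Proof. by move=> mB; apply: bigcap_measurableType => i _; exact: mpre. Qed.

Lemma chain_indep_future k m (A : set S) (B : nat -> set T) :
  measurable A -> (forall i, measurable (B i)) ->
  P (chain k @^-1` A `&` \bigcap_(i in `I_m) (Y (k + i)%N @^-1` B i)) =
  P (chain k @^-1` A) * \prod_(i < m) P (Y (k + i)%N @^-1` B i).
Proof.
elim: k m A B => [|k IH] m A B mA mB.
  have [s0A|s0A] := pselect (A s0).
    rewrite [_ @^-1` A](_ : _ = setT); last by apply/seteqP; split.
    by rewrite setTI probability_setT mul1e; exact: iY.
  rewrite [_ @^-1` A](_ : _ = set0); last by apply/seteqP; split.
  by rewrite set0I measure0 mul0e.
set E := \bigcap_(i in _) _.
have mE : measurable E by apply: mfut.
set c := \prod_(i < m) _.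
have cE : c = P E.
  have := independent_seq_shift _ k.+1 iY m B mB.
  by move=> /esym.
pose sy w := (chain k w, Y k w).
have msy : measurable_fun setT sy.
  exact: measurable_fun_pair (measurable_chain k) (mY k).
pose c' : {nonneg R} := NngNum (fine_ge0 (measure_ge0 P E)).
pose m1 : {measure set (S * T) -> \bar R} :=
  measure_function_pushforward__canonical__measure_function_Measure (mrestr P mE) msy.
pose m2 : {measure set (S * T) -> \bar R} := mscale c' 
  (measure_function_pushforward__canonical__measure_function_Measure P msy).
have mch D : measurable D -> measurable (chain k @^-1` D).
  by move=> mD; rewrite -[X in measurable X]setTI; exact: measurable_chain.
have c'E : c'%:num%:E = P E by rewrite /= fineK// fin_num_measure.
have rect A' B' : measurable A' -> measurable B' -> m1 (A' `*` B') = m2 (A' `*` B').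
  move=> mA' mB'.
  transitivity (P (chain k @^-1` A') * (P (Y k @^-1` B') * P E)).
    have := IH m.+1 A' (fun i => if i is i'.+1 then B i' else B') mA'.
    rewrite big_ord_recl/= addn0.
    under [X in _ * (_ * X)]eq_bigr do rewrite /bump/= addnA addn1.
    rewrite -/c cE => <-; last by case.
    rewrite /m1/= /pushforward /mrestr; congr (P _).
    apply/seteqP; split=> w /=.
      move=> [[wA wB] wE]; split => // -[|i] /= im; first by rewrite addn0.
      by rewrite addnS -addSn; exact: wE.
    move=> [wA wB]; split; first by split => //; have := wB 0%N isT; rewrite addn0.
    by move=> i /= im; have := wB i.+1 im; rewrite addnS -addSn.
  rewrite /m2/= /mscale/= -/(c'%:num) c'E /pushforward muleA muleC; congr (_ * _).
  have := IH 1%N A' (fun=> B') mA' (fun=> mB').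
  rewrite big_ord1 addn0 => <-; congr (P _); apply/seteqP; split=> w /=.
    by move=> [wA wB]; split => //; have := wB 0%N isT; rewrite addn0.
  by move=> [wA wB]; split => // -[|]//= _; rewrite addn0.
have := @rectangle_measure_unique _ _ _ _ _ m1 m2 _ rect (F @^-1` A).
rewrite -/c cE /m1 /m2/= /mscale/= -/(c'%:num) c'E /pushforward /mrestr => h.
rewrite muleC -h//.
  by rewrite preimage_setT setTI (le_lt_trans (probability_le1 _ mE))// ltry.
by rewrite -[X in measurable X]setTI; exact: mF.
Qed.

(** State and next input are independent, so their joint law is a product and Tonelli's theorem
    applies. This replaces conditioning on the past. *)
Lemma chain_expectation k (h : S * T -> \bar R) :
  measurable_fun setT h -> (forall z, 0 <= h z) ->
  \int[P]_w h (chain k w, Y k w) =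
  \int[P]_w \int[P]_w' h (chain k w, Y k w').
Proof.
move=> mh h0.
pose sy w := (chain k w, Y k w).
have msy : measurable_fun setT sy.
  exact: measurable_fun_pair (measurable_chain k) (mY k).
pose chf : {mfun Omega >-> S} :=
  HB.pack (chain k) (isMeasurableFun.Build _ _ _ _ (chain k) (measurable_chain k)).
pose Yf : {mfun Omega >-> T} :=
  HB.pack (Y k) (isMeasurableFun.Build _ _ _ _ (Y k) (mY k)).
pose syf : {mfun Omega >-> (S * T)%type} :=
  HB.pack sy (isMeasurableFun.Build _ _ _ _ sy msy).
transitivity (\int[distribution P syf]_z h z).
  by rewrite ge0_integral_distribution.
transitivity (\int[(distribution P chf \x distribution P Yf)%E]_z h z).
  apply: eq_measure_integral => A mA _.
  apply/esym/product_measure_unique => // A' B' mA' mB'.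
  rewrite /distribution /pushforward/=.
  have := chain_indep_future k 1 A' (fun=> B') mA' (fun=> mB').
  rewrite big_ord1 addn0 => <-; congr (P _); apply/seteqP; split=> w /=.
    by move=> [wA wB]; split => // -[|]//= _; rewrite addn0.
  by move=> [wA wB]; split => //; have := wB 0%N isT; rewrite addn0.
rewrite fubini_tonelli1// ge0_integral_distribution//; first last.
- by move=> s; apply: integral_ge0.
- exact: measurable_fun_fubini_tonelli_F.
apply: eq_integral => w _ /=.
rewrite /fubini_F ge0_integral_distribution//.
exact: (measurableT_comp mh (measurable_pair1 _)).
Qed.
End MarkovChain.

(** * Real-valued means *)

Section HasMean.
Context {R : realType} {disp : measure_display} {Omega : measurableType disp}.
Variable P : probability Omega R.
Implicit Types (f g : Omega -> R) (m : R).

Definition has_mean f m : Prop :=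
  P.-integrable setT (EFin \o f) /\ (\int[P]_w (f w)%:E)%E = m%:E.

Lemma has_mean_measurable f m : has_mean f m -> measurable_fun setT f.
Proof. by move=> [/measurable_int/measurable_EFinP]. Qed.

Lemma has_meanD f g m l : has_mean f m -> has_mean g l ->
  has_mean (fun w => f w + g w) (m + l).
Proof.
move=> [fi fm] [gi gl]; split.
  by have := integrableD measurableT fi gi; apply: eq_integrable.
under eq_integral do rewrite EFinD.
by rewrite integralD// fm gl.
Qed.

Lemma has_meanZ f m c : has_mean f m -> has_mean (fun w => c * f w) (c * m).
Proof.
move=> [fi fm]; split; first exact: (integrableZl measurableT c fi).
under eq_integral do rewrite EFinM.
by rewrite integralZl// fm.
Qed.

Lemma has_mean_cst m : has_mean (fun=> m) m.
Proof.
split; first exact: finite_measure_integrable_cst.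
by rewrite integral_cst//= probability_setT mule1.
Qed.

Lemma has_meanB f g m l : has_mean f m -> has_mean g l ->
  has_mean (fun w => f w - g w) (m - l).
Proof.
move=> hf /(has_meanZ _ _ (-1)); rewrite mulN1r => hg.
have := has_meanD _ _ _ _ hf hg; congr has_mean.
by apply/funext => w; rewrite mulN1r.
Qed.

Lemma has_mean_sum I (s : seq I) (h : I -> Omega -> R) (m : I -> R) :
  (forall i, has_mean (h i) (m i)) ->
  has_mean (fun w => \sum_(i <- s) h i w) (\sum_(i <- s) m i).
Proof.
move=> hm; elim: s => [|i s IH].
  by rewrite big_nil; under eq_fun do rewrite big_nil; exact: has_mean_cst.
by rewrite big_cons; under eq_fun do rewrite big_cons; exact: has_meanD.
Qed.

Lemma has_mean_le f g m l : has_mean f m -> has_mean g l ->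
  (forall w, f w <= g w) -> m <= l.
Proof.
move=> [fi fm] [gi gl] fg; rewrite -lee_fin -fm -gl.
by apply: le_integral => // w _; rewrite lee_fin.
Qed.

Lemma has_mean_ge0 f m : measurable_fun setT f -> (forall w, 0 <= f w) ->
  (\int[P]_w (f w)%:E)%E = m%:E -> has_mean f m.
Proof.
move=> mf f0 fm; split => //; apply/integrableP; split; first exact/measurable_EFinP.
under eq_integral do rewrite /= ger0_norm//.
by rewrite fm ltry.
Qed.

Lemma has_mean_ge0_le f m : measurable_fun setT f -> (forall w, 0 <= f w) ->
  (\int[P]_w (f w)%:E <= m%:E)%E -> exists2 l, 0 <= l <= m & has_mean f l.
Proof.
move=> mf f0 fm.
have i0 : (0 <= \int[P]_w (f w)%:E)%E by apply: integral_ge0 => w _; rewrite lee_fin.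
have ifin : (\int[P]_w (f w)%:E)%E \is a fin_num.
  by rewrite ge0_fin_numE// (le_lt_trans fm) ?ltry.
exists (fine (\int[P]_w (f w)%:E)).
  by rewrite -!lee_fin fineK// i0.
by apply: has_mean_ge0 => //; rewrite fineK.
Qed.

Lemma has_mean_dominated f g m : measurable_fun setT f ->
  (forall w, 0 <= f w <= g w) -> has_mean g m ->
  exists2 l, 0 <= l <= m & has_mean f l.
Proof.
move=> mf fg hg; have f0 w : 0 <= f w by case/andP: (fg w).
apply: has_mean_ge0_le => //; rewrite -hg.2.
apply: ge0_le_integral => //.
- by move=> w _; rewrite lee_fin.
- by apply/measurable_EFinP.
- by apply/measurable_EFinP; exact: has_mean_measurable hg.
- by move=> w _; rewrite lee_fin; case/andP: (fg w).
Qed.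

Lemma has_mean_normr_le f g m l : measurable_fun setT f ->
  (forall w, `|f w| <= g w) -> has_mean g m ->
  (\int[P]_w (f w)%:E)%E = l%:E -> has_mean f l.
Proof.
move=> mf fg [gi _] fl; split => //.
apply: le_integrable gi => //; first exact/measurable_EFinP.
by move=> w _; rewrite /= lee_fin (le_trans (fg w))// ler_norm.
Qed.

(** Integrate the pointwise inequality [c * \1_E <= f]. *)
Lemma has_mean_markov f m c (E : set Omega) : has_mean f m -> 0 < c ->
  (forall w, 0 <= f w) -> measurable E -> (forall w, E w -> c <= f w) ->
  (P E <= (m / c)%:E)%E.
Proof.
move=> hf c0 f0 mE Ef.
have hE : has_mean (\1_E) (fine (P E)).
  apply: has_mean_ge0; first exact: measurable_indic.
    by move=> w; rewrite indicE.
  by rewrite integral_indic// setIT fineK// fin_num_measure.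
rewrite -[P E]fineK ?fin_num_measure// lee_fin ler_pdivlMr// mulrC.
apply: has_mean_le (has_meanZ _ _ c hE) hf _ => w.
rewrite indicE; case: (boolP (w \in E)) => [/set_mem/Ef|_].
  by rewrite mulr1.
by rewrite mulr0.
Qed.

End HasMean.

(** * Moments of one step *)

Section Tuples.
Context {R : realType} {d : nat}.
Implicit Types s z : d.-tuple R.

Definition dotp s z : R := \sum_(j < d) tnth s j * tnth z j.

Definition addt s z : d.-tuple R := [tuple tnth s j + tnth z j | j < d].

Definition tail_sqr (A : R) z : R :=
  if A < eucl_norm z ^+ 2 then eucl_norm z ^+ 2 else 0.

Definition trunc_sqr (A : R) z : R := eucl_norm z ^+ 2 - tail_sqr A z.

Lemma eucl_norm2_add s z : eucl_norm (addt s z) ^+ 2 =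
  eucl_norm s ^+ 2 + (2 * dotp s z + eucl_norm z ^+ 2).
Proof.
rewrite !eucl_norm2E /dotp mulr_sumr -!big_split/=.
by apply: eq_bigr => j _; rewrite tnth_mktuple; ring.
Qed.

Lemma tail_sqr_ge0 A z : 0 <= tail_sqr A z.
Proof. by rewrite /tail_sqr; case: ifP => // _; exact: sqr_ge0. Qed.

Lemma trunc_sqr_bounds A z : 0 <= A -> 0 <= trunc_sqr A z <= A.
Proof.
rewrite /trunc_sqr /tail_sqr => A0; case: ltP => h; first by rewrite subrr lexx.
by rewrite subr0 sqr_ge0.
Qed.

Lemma sqr_tnth_le z j : tnth z j ^+ 2 <= eucl_norm z ^+ 2.
Proof.
rewrite eucl_norm2E (bigD1 j)//= lerDl sumr_ge0// => i _; exact: sqr_ge0.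
Qed.

End Tuples.

Section TupleMeasurability.
Context {R : realType} {d : nat} {disp : measure_display} {T : measurableType disp}.

Lemma measurable_tnth_comp (f : T -> d.-tuple R) j :
  measurable_fun setT f -> measurable_fun setT (fun w => tnth (f w) j).
Proof. by move=> mf; exact: (measurableT_comp (measurable_tnth j) mf). Qed.

Lemma measurable_dotp (f g : T -> d.-tuple R) :
  measurable_fun setT f -> measurable_fun setT g ->
  measurable_fun setT (fun w => dotp (f w) (g w)).
Proof.
move=> mf mg; apply: measurable_sum => j.
by apply: measurable_funM; exact: measurable_tnth_comp.
Qed.

Lemma measurable_addt (f g : T -> d.-tuple R) :
  measurable_fun setT f -> measurable_fun setT g ->
  measurable_fun setT (fun w => addt (f w) (g w)).
Proof.
move=> mf mg; apply/measurable_fun_tnthP => j.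
rewrite (_ : _ \o _ = fun w => tnth (f w) j + tnth (g w) j).
  by apply: measurable_funD; exact: measurable_tnth_comp.
by apply/funext => w; rewrite /= tnth_mktuple.
Qed.

Lemma measurable_eucl_norm2 (f : T -> d.-tuple R) :
  measurable_fun setT f -> measurable_fun setT (fun w => eucl_norm (f w) ^+ 2).
Proof.
move=> mf; under eq_fun do rewrite eucl_norm2E.
by apply: measurable_sum => j; apply: measurable_funX; exact: measurable_tnth_comp.
Qed.

Lemma measurable_tail_sqr A (f : T -> d.-tuple R) :
  measurable_fun setT f -> measurable_fun setT (fun w => tail_sqr A (f w)).
Proof.
move=> mf; apply: measurable_fun_ifT => //; last exact: measurable_eucl_norm2.
by apply: measurable_fun_ltr => //; exact: measurable_eucl_norm2.
Qed.

Lemma measurable_trunc_sqr A (f : T -> d.-tuple R) :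
  measurable_fun setT f -> measurable_fun setT (fun w => trunc_sqr A (f w)).
Proof.
move=> mf; apply: measurable_funB; first exact: measurable_eucl_norm2.
exact: measurable_tail_sqr.
Qed.

End TupleMeasurability.

Section StepMoments.
Context {R : realType} {d : nat} {disp : measure_display}.
Context {Omega : measurableType disp}.
Variable P : probability Omega R.
Variables (sigma A e : R).

(** [e] is the exact tail mean because it enters the centring of the martingale, whereas [sigma] is
    only an upper bound. *)
Record step_moments (Z : Omega -> d.-tuple R) : Prop := StepMoments {
  step_measurable : measurable_fun setT Z;
  step_mean : forall j, has_mean P (fun w => tnth (Z w) j) 0;
  step_cov : forall j k, j != k ->
    has_mean P (fun w => tnth (Z w) j * tnth (Z w) k) 0;
  step_var : forall j, exists2 v, v <= sigma &
    has_mean P (fun w => tnth (Z w) j ^+ 2) v;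
  step_norm : has_mean P (fun w => eucl_norm (Z w) ^+ 2) 1;
  step_tail : has_mean P (fun w => tail_sqr A (Z w)) e }.

Variable Z : Omega -> d.-tuple R.
Hypothesis hZ : step_moments Z.
Hypothesis A0 : 0 <= A.

Lemma has_mean_dotp s : has_mean P (fun w => dotp s (Z w)) 0.
Proof.
rewrite -[X in has_mean _ _ X](_ : \sum_(j < d) tnth s j * 0 = 0).
  by apply: has_mean_sum => j; apply: has_meanZ; exact: step_mean.
by rewrite big1// => j _; rewrite mulr0.
Qed.

(** Only the diagonal of the double sum survives, so the largest coordinate variance appears with no
    factor [d]. *)
Lemma has_mean_dotp2 s : exists2 q, q <= sigma * eucl_norm s ^+ 2 &
  has_mean P (fun w => dotp s (Z w) ^+ 2) q.
Proof.
have [v Hv] := choice (fun j => let: ex_intro2 v a b := step_var _ hZ j in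
  ex_intro (fun v => v <= sigma /\ has_mean P (fun w => tnth (Z w) j ^+ 2) v)
    v (conj a b)).
exists (\sum_(j < d) tnth s j ^+ 2 * v j).
  rewrite eucl_norm2E mulr_sumr; apply: ler_sum => j _.
  by rewrite mulrC ler_wpM2r ?sqr_ge0//; case: (Hv j).
have -> : \sum_(j < d) tnth s j ^+ 2 * v j = \sum_(j < d) \sum_(k < d)
    (tnth s j * tnth s k) * (if j == k then v j else 0).
  apply: eq_bigr => j _; rewrite (bigD1 j)//= eqxx -expr2 big1 ?addr0// => k kj.
  by rewrite eq_sym (negbTE kj) mulr0.
under eq_fun => w.
  rewrite expr2 /dotp big_distrlr/=.
  under eq_bigr do under eq_bigr do rewrite mulrACA.
  over.
apply: has_mean_sum => j; apply: has_mean_sum => k; apply: has_meanZ.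
case: eqVneq => [<-|jk]; last exact: step_cov.
by under eq_fun do rewrite -expr2; case: (Hv j).
Qed.

Lemma has_mean_norm_add s :
  has_mean P (fun w => eucl_norm (addt s (Z w)) ^+ 2) (eucl_norm s ^+ 2 + 1).
Proof.
under eq_fun do rewrite eucl_norm2_add.
apply: has_meanD; first exact: has_mean_cst.
rewrite -[X in has_mean _ _ X](_ : 2 * 0 + 1 = 1); last by rewrite mulr0 add0r.
by apply: has_meanD (step_norm _ hZ); apply: has_meanZ; exact: has_mean_dotp.
Qed.

Lemma has_mean_trunc : has_mean P (fun w => trunc_sqr A (Z w)) (1 - e).
Proof. exact: has_meanB (step_norm _ hZ) (step_tail _ hZ). Qed.

Lemma tail_mean_bounds : 0 <= e <= 1.
Proof.
apply/andP; split.
  apply: has_mean_le (has_mean_cst P 0) (step_tail _ hZ) _ => w.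
  exact: tail_sqr_ge0.
apply: has_mean_le (step_tail _ hZ) (step_norm _ hZ) _ => w.
rewrite /tail_sqr; case: ifP => // _; exact: sqr_ge0.
Qed.

(** The change of the squared norm when [z] is added to [s], with the square of [z] truncated and
    centred at its mean [1 - e]. *)
Definition increment (s z : d.-tuple R) : R := 2 * dotp s z + (trunc_sqr A z - (1 - e)).

Lemma has_mean_increment s : has_mean P (fun w => increment s (Z w)) 0.
Proof.
rewrite -[X in has_mean _ _ X](_ : 2 * 0 + ((1 - e) - (1 - e)) = 0); last by ring.
apply: has_meanD; first by apply: has_meanZ; exact: has_mean_dotp.
exact: has_meanB has_mean_trunc (has_mean_cst _ _).
Qed.

Lemma measurable_increment {disp' : measure_display} (T : measurableType disp')
    (f g : T -> d.-tuple R) :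
  measurable_fun setT f -> measurable_fun setT g ->
  measurable_fun setT (fun w => increment (f w) (g w)).
Proof.
move=> mf mg; apply: measurable_funD.
  by apply: measurable_funM => //; exact: measurable_dotp.
by apply: measurable_funB => //; exact: measurable_trunc_sqr.
Qed.

(** With [a] the scalar product and [b] the centred truncated square, (2a + b)^2 is at most 8a^2 +
    2b^2, the difference being (2a - b)^2. A variable T with values in [0, A] satisfies T^2 <= A T,
    so here b^2 has mean at most [A]. *)
Lemma has_mean_increment2 s :
  exists2 q, 0 <= q <= 8 * sigma * eucl_norm s ^+ 2 + 2 * A &
  has_mean P (fun w => increment s (Z w) ^+ 2) q.
Proof.
have [q0 q0le hq0] := has_mean_dotp2 s.
have mT : measurable_fun setT (fun w => trunc_sqr A (Z w)).
  exact: measurable_trunc_sqr (step_measurable _ hZ).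
have [t tle ht] : exists2 t, 0 <= t <= A * (1 - e) &
    has_mean P (fun w => trunc_sqr A (Z w) ^+ 2) t.
  apply: has_mean_dominated (has_meanZ _ _ _ A has_mean_trunc).
    exact: measurable_funX.
  move=> w; have /andP[T0 TA] := trunc_sqr_bounds A (Z w) A0.
  by rewrite sqr_ge0 expr2 ler_wpM2r.
have hT : has_mean P (fun w => (trunc_sqr A (Z w) - (1 - e)) ^+ 2)
    (t - 2 * (1 - e) * (1 - e) + (1 - e) ^+ 2).
  under eq_fun => w.
    rewrite (_ : _ ^+ 2 = trunc_sqr A (Z w) ^+ 2 -
      2 * (1 - e) * trunc_sqr A (Z w) + (1 - e) ^+ 2); last by ring.
    over.
  apply: has_meanD (has_mean_cst _ _); apply: has_meanB => //.
  exact/has_meanZ/has_mean_trunc.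
have [|w|q qle hq] := has_mean_dominated _ (fun w => increment s (Z w) ^+ 2) _ _
  _ _ (has_meanD _ _ _ _ _ (has_meanZ _ _ _ 8 hq0) (has_meanZ _ _ _ 2 hT)).
- apply: measurable_funX; apply: measurable_increment => //.
  exact: step_measurable.
- rewrite sqr_ge0/= /increment -subr_ge0.
  set a := dotp _ _; set b := trunc_sqr _ _ - _.
  rewrite (_ : _ - _ = (2 * a - b) ^+ 2); last by ring.
  exact: sqr_ge0.
exists q => //; case/andP: qle => -> /=; have /andP[e0 e1] := tail_mean_bounds.
have /andP[_ tA] := tle.
have := mulr_ge0 A0 e0; have := sqr_ge0 (1 - e); lra.
Qed.

End StepMoments.

(** * The stopped martingale and the maximal inequality *)

Section MaximalInequality.
Context {R : realType} {d : nat} {disp : measure_display}.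
Context {Omega : measurableType disp}.
Variable P : probability Omega R.
Variables (sigma A e lam : R) (Y : nat -> Omega -> d.-tuple R).
Hypothesis iY : independent_seq P Y.
Hypothesis hY : forall i, step_moments P sigma A e (Y i).
Hypothesis A0 : 0 <= A.
Hypothesis sigma0 : 0 <= sigma.

(* The second coordinate is the truncated martingale
   [|S_k|^2 - tails - k (1 - e)], stopped once it leaves [-lam, lam]:
   its maximum exceeds [lam] iff its final value does. *)
Definition stopped_step (q : (d.-tuple R * R) * d.-tuple R) : d.-tuple R * R :=
  (addt q.1.1 q.2,
   q.1.2 + (if `|q.1.2| <= lam then increment A e q.1.1 q.2 else 0)).

Lemma measurable_stopped_step : measurable_fun setT stopped_step.
Proof.
have m11 : measurable_fun setT (fun q : (d.-tuple R * R) * d.-tuple R => q.1.1).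
  exact: (measurableT_comp measurable_fst measurable_fst).
have m12 : measurable_fun setT (fun q : (d.-tuple R * R) * d.-tuple R => q.1.2).
  exact: (measurableT_comp measurable_snd measurable_fst).
have m2 : measurable_fun setT (fun q : (d.-tuple R * R) * d.-tuple R => q.2).
  exact: measurable_snd.
apply: measurable_fun_pair; first exact: measurable_addt.
apply: measurable_funD => //; apply: measurable_fun_ifT => //.
  by apply: measurable_fun_ler => //; exact: measurableT_comp.
exact: measurable_increment.
Qed.

Definition origin : d.-tuple R := [tuple 0 | j < d].

Definition stopped k w := chain stopped_step (origin, 0) Y k w.

Let mY i : measurable_fun setT (Y i).
Proof. exact: step_measurable (hY i). Qed.

Lemma measurable_stopped k : measurable_fun setT (stopped k).
Proof. exact: measurable_chain measurable_stopped_step mY k. Qed.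

Lemma stopped_walk k w : (stopped k w).1 = walk Y k w.
Proof.
apply: eq_from_tnth => j; rewrite tnth_mktuple.
elim: k => [|k IH]; first by rewrite /stopped/= tnth_mktuple big_ord0.
by rewrite big_ord_recr/= -IH /stopped/= tnth_mktuple.
Qed.

(** The walk coordinate is never stopped, so each step adds exactly 1. This average controls the
    state-dependent variance of the martingale increments. *)
Lemma has_mean_walk k : has_mean P (fun w => eucl_norm (stopped k w).1 ^+ 2) k%:R.
Proof.
have ms k' : measurable_fun setT (fun w => (stopped k' w).1).
  exact: (measurableT_comp measurable_fst (measurable_stopped k')).
elim: k => [|k IH].
  rewrite [X in has_mean _ X](_ : _ = cst 0); first exact: has_mean_cst.
  apply/funext => w; rewrite eucl_norm2E big1// => j _.
  by rewrite /stopped/= tnth_mktuple expr0n.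
apply: has_mean_ge0 => [||]; first exact: measurable_eucl_norm2.
  by move=> w; exact: sqr_ge0.
have := chain_expectation P stopped_step (origin, 0) Y measurable_stopped_step mY iY k
  (fun q => (eucl_norm (stopped_step q).1 ^+ 2)%:E).
move=> ->; first last.
- by move=> q; rewrite lee_fin sqr_ge0.
- apply/measurable_EFinP; apply: measurable_eucl_norm2.
  exact: (measurableT_comp measurable_fst measurable_stopped_step).
under eq_integral do rewrite (has_mean_norm_add _ _ _ _ _ (hY k) _).2.
by rewrite (has_meanD _ _ _ _ _ IH (has_mean_cst P 1)).2 natr1.
Qed.

(** Passing from [k] to [k.+1] raises the mean square by at most [8 * sigma * k%:R + 2 * A]; the sum
    of these is bounded by the number of steps times a common bound. *)
Lemma has_mean_stopped k : exists2 m, 0 <= m <= k%:R * (8 * sigma * k%:R + 2 * A) &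
  has_mean P (fun w => (stopped k w).2 ^+ 2) m.
Proof.
have ms k' : measurable_fun setT (fun w => (stopped k' w).2).
  exact: (measurableT_comp measurable_snd (measurable_stopped k')).
elim: k => [|k [m mle IH]].
  exists 0; first by rewrite mul0r lexx.
  rewrite [X in has_mean _ X](_ : _ = cst 0); first exact: has_mean_cst.
  by apply/funext => w; rewrite /stopped/= expr0n.
pose b := m + 8 * sigma * k%:R + 2 * A.
have [|||l lle hl] := has_mean_ge0_le P (fun w => (stopped k.+1 w).2 ^+ 2) b.
- exact: measurable_funX.
- by move=> w; exact: sqr_ge0.
- have := chain_expectation P stopped_step (origin, 0) Y measurable_stopped_step mY iY k
    (fun q => ((stopped_step q).2 ^+ 2)%:E).
  move=> ->; first last.
  + by move=> q; rewrite lee_fin sqr_ge0.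
  + apply/measurable_EFinP; apply: measurable_funX.
    exact: (measurableT_comp measurable_snd measurable_stopped_step).
  have hb : has_mean P (fun w => (stopped k w).2 ^+ 2 +
      8 * sigma * (eucl_norm (stopped k w).1 ^+ 2) + 2 * A) b.
    apply: has_meanD (has_mean_cst _ _); apply: has_meanD => //.
    by apply: has_meanZ; exact: has_mean_walk.
  rewrite -hb.2; apply: ge0_le_integral => //.
  + by move=> w _; apply: integral_ge0 => w' _; rewrite lee_fin sqr_ge0.
  (* The inner integral has to be measurable in [w]: it is a Tonelli partial integral, as a function
     of the state, evaluated at [stopped k w]. *)
  + pose H (q : (d.-tuple R * R) * Omega) : \bar R :=
      ((stopped_step (q.1, Y k q.2)).2 ^+ 2)%:E.
    have mH : measurable_fun setT H.
      apply/measurable_EFinP; apply: measurable_funX.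
      apply: (measurableT_comp measurable_snd).
      apply: (measurableT_comp measurable_stopped_step).
      apply: measurable_fun_pair measurable_fst _.
      exact: (measurableT_comp (mY k) measurable_snd).
    have := @measurable_fun_fubini_tonelli_F _ _ _ _ _ P H mH
      (fun q => ltac:(by rewrite lee_fin sqr_ge0)).
    by move=> mF; exact: (measurableT_comp mF (measurable_stopped k)).
  + by apply/measurable_EFinP; exact: has_mean_measurable hb.
  + move=> w _; rewrite -/(stopped k w); case: (stopped k w) => s x /=.
    have [q /andP[q0 qle] hq] := has_mean_increment2 _ _ _ _ _ (hY k) A0 s.
    have hs := mulr_ge0 (mulr_ge0 (ler0n R 8) sigma0) (sqr_ge0 (eucl_norm s)).
    (* While running, the cross term vanishes since the increment is centred; after stopping, the
       integrand is constant. *)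
    rewrite /stopped_step/=; case: (`|x| <= lam).
      have hm : has_mean P (fun w' => (x + increment A e s (Y k w')) ^+ 2)
          (x ^+ 2 + (2 * x) * 0 + q).
        under eq_fun do rewrite sqrrD -mulr_natl mulrA.
        apply: has_meanD hq; apply: has_meanD; first exact: has_mean_cst.
        exact: has_meanZ (has_mean_increment _ _ _ _ _ (hY k) s).
      by rewrite hm.2 lee_fin; lra.
    rewrite addr0 (has_mean_cst P (x ^+ 2)).2 lee_fin.
    have := A0; lra.
exists l => //; case/andP: lle => -> /= /le_trans; apply.
rewrite /b -natr1; case/andP: mle => _; have := mulr_ge0 A0 (ler0n R k).
have := mulr_ge0 sigma0 (ler0n R k).
have := mulr_ge0 (mulr_ge0 sigma0 (ler0n R k)) (ler0n R k); have := A0; have := sigma0.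
nra.
Qed.
End MaximalInequality.

Definition deviation_event {R : realType} {d : nat} {T : Type}
    (Y : nat -> T -> d.-tuple R) (N : nat) (c : R) : set T :=
  \bigcup_(l in `I_N.+1) [set w | c < `|eucl_norm (walk Y l w) ^+ 2 - l%:R|].

Lemma measurable_deviation_event {R : realType} {d : nat}
    {disp : measure_display} {T : measurableType disp}
    (Y : nat -> T -> d.-tuple R) (N : nat) (c : R) :
  (forall i, measurable_fun setT (Y i)) -> measurable (deviation_event Y N c).
Proof.
move=> mY; apply: bigcup_measurable => l _; apply: measurable_set_ltr => //.
apply: measurableT_comp => //; apply: measurable_funB => //.
apply: measurable_eucl_norm2; apply/measurable_fun_tnthP => j.
exact: measurable_walk.
Qed.

Section StoppedPath.
Context {R : realType} {d : nat} {disp : measure_display}.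
Context {Omega : measurableType disp}.
Variables (A e lam : R) (Y : nat -> Omega -> d.-tuple R).
Local Notation S := (stopped A e lam Y).

Lemma stopped_bounded N w l : `|(S N w).2| <= lam -> (l <= N)%N ->
  `|(S l w).2| <= lam.
Proof.
move=> hN lN; case: leP => // hl.
suff h k : (S (l + k)%N w).2 = (S l w).2.
  by move: hN; rewrite -(subnKC lN) h leNgt hl.
elim: k => [|k IH]; first by rewrite addn0.
rewrite addnS /stopped/= -!/(stopped _ _ _ _ _ _) IH.
by rewrite leNgt hl/= addr0.
Qed.

(** Up to time [N] the chain has not been frozen, and truncated part plus tail give the full square.
    The term [l%:R * e] accounts for centring at [1 - e] instead of 1. *)
Lemma stopped_decomposition N w l : `|(S N w).2| <= lam -> (l <= N)%N ->
  eucl_norm (walk Y l w) ^+ 2 - l%:R =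
  (S l w).2 + \sum_(i < l) tail_sqr A (Y i w) - l%:R * e.
Proof.
move=> hN; elim: l => [_|l IH lN].
  rewrite -(stopped_walk A e lam) eucl_norm2E big1 ?big_ord0 ?mul0r ?addr0//.
  by move=> j _; rewrite /stopped/= tnth_mktuple expr0n.
have := IH (ltnW lN); have hl := stopped_bounded _ _ _ hN (ltnW lN).
rewrite -!(stopped_walk A e lam) big_ord_recr/= /stopped/= -!/(stopped _ _ _ _ _ _).
rewrite hl eucl_norm2_add /increment /trunc_sqr -natr1; lra.
Qed.

Lemma deviation_le N w rho l : `|(S N w).2| <= lam ->
  \sum_(i < N) tail_sqr A (Y i w) <= rho -> 0 <= rho -> 0 <= e -> (l <= N)%N ->
  `|eucl_norm (walk Y l w) ^+ 2 - l%:R| <= lam + rho + N%:R * e.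
Proof.
move=> hN hrho rho0 e0 lN; rewrite (stopped_decomposition _ _ _ hN lN).
have hl := stopped_bounded _ _ _ hN lN.
have tle : \sum_(i < l) tail_sqr A (Y i w) <= \sum_(i < N) tail_sqr A (Y i w).
  rewrite -(subnKC lN) big_split_ord/= lerDl.
  by apply: sumr_ge0 => i _; exact: tail_sqr_ge0.
have t0 : 0 <= \sum_(i < l) tail_sqr A (Y i w).
  by apply: sumr_ge0 => i _; exact: tail_sqr_ge0.
have le0 : 0 <= l%:R * e by exact: mulr_ge0.
have leN : l%:R * e <= N%:R * e by apply: ler_wpM2r => //; rewrite ler_nat.
move: hl; rewrite !ler_norml => /andP[h1 h2]; apply/andP; split; lra.
Qed.

End StoppedPath.

Section DeviationProbability.
Context {R : realType} {d : nat} {disp : measure_display}.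
Context {Omega : measurableType disp}.
Variable P : probability Omega R.
Variables (sigma A e delta : R) (Y : nat -> Omega -> d.-tuple R) (N : nat).
Hypothesis iY : independent_seq P Y.
Hypothesis hY : forall i, step_moments P sigma A e (Y i).
Hypothesis A0 : 0 <= A.
Hypothesis sigma0 : 0 <= sigma.
Hypothesis delta0 : 0 < delta.
Hypothesis e_delta : e <= delta.
Hypothesis N0 : (0 < N)%N.

(** The threshold is shared equally by the martingale, the tails and the deterministic term
    [N%:R * e]. Chebyshev's inequality at level [delta * N%:R] yields the first two summands,
    Markov's inequality for the tails the third. *)
Lemma deviation_probability :
  (P (deviation_event Y N (3 * delta * N%:R)) <=
   (8 * sigma / delta ^+ 2 + 2 * A / (delta ^+ 2 * N%:R) + e / delta)%:E)%E.
Proof.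
have mY i : measurable_fun setT (Y i) by exact: step_measurable (hY i).
have NR : 0 < N%:R :> R by rewrite ltr0n.
have dN0 : 0 < delta * N%:R by exact: mulr_gt0.
pose lam := delta * N%:R.
pose E1 := [set w | lam < `|(stopped A e lam Y N w).2|].
pose E2 := [set w | lam < \sum_(i < N) tail_sqr A (Y i w)].
have mE1 : measurable E1.
  apply: measurable_set_ltr => //; apply: measurableT_comp => //.
  apply: (measurableT_comp measurable_snd).
  exact: (measurable_stopped P sigma A e lam Y hY).
have mE2 : measurable E2.
  apply: measurable_set_ltr => //; apply: measurable_sum => i.
  exact: measurable_tail_sqr.
have /andP[e0 e1] : 0 <= e <= 1 := tail_mean_bounds _ _ _ _ _ (hY 0%N).
have P1 : (P E1 <= (8 * sigma / delta ^+ 2 + 2 * A / (delta ^+ 2 * N%:R))%:E)%E.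
  have [m /andP[m0 mle] hm] := has_mean_stopped P sigma A e lam Y iY hY A0 sigma0 N.
  apply: le_trans (has_mean_markov P _ _ (lam ^+ 2) E1 hm _ _ mE1 _) _.
  - exact: exprn_gt0.
  - by move=> w; exact: sqr_ge0.
  - move=> w /ltW h; rewrite -[leRHS]real_normK ?num_real//.
    by rewrite lerXn2r// nnegrE ltW.
  rewrite lee_fin ler_pdivrMr ?exprn_gt0//; apply: le_trans mle _.
  rewrite le_eqVlt; apply/orP; left; apply/eqP; rewrite /lam.
  by field; rewrite !gt_eqF.
have P2 : (P E2 <= (e / delta)%:E)%E.
  have hs := has_mean_sum P _ (index_enum 'I_N) (fun i : 'I_N => fun w => tail_sqr A (Y i w))
    (fun=> e) (fun i => step_tail _ _ _ _ _ (hY i)).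
  apply: le_trans (has_mean_markov P _ _ lam E2 hs dN0 _ mE2 _) _.
  - by move=> w; apply: sumr_ge0 => i _; exact: tail_sqr_ge0.
  - by move=> w /ltW.
  rewrite lee_fin sumr_const card_ord -mulr_natl le_eqVlt; apply/orP; left.
  by apply/eqP; rewrite /lam; field; rewrite !gt_eqF.
apply: (@le_trans _ _ (P (E1 `|` E2))).
  apply: le_measure; rewrite ?inE.
  - exact: measurable_deviation_event.
  - exact: measurableU.
  move=> w [l /= lN]; apply: contraPP => /not_orP[/negP h1 /negP h2].
  apply/negP; rewrite -leNgt; move: h1 h2; rewrite -!leNgt => h1 h2.
  have := deviation_le _ _ _ _ _ _ _ _ h1 h2 (ltW dN0) e0 lN.
  move=> /le_trans; apply.
  have : N%:R * e <= N%:R * delta by rewrite ler_wpM2l.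
  rewrite /lam; lra.
apply: le_trans (measureU2 _ _ _) _ => //.
by rewrite EFinD; apply: leeD.
Qed.

End DeviationProbability.

(** * From deviations at finitely many bases to the spiral *)

Section WalkGeometry.
Context {R : realType} {d : nat} {T : Type}.
Variable Y : nat -> T -> d.-tuple R.

Lemma eucl_norm_walk_shift g l w :
  eucl_norm (walk (fun i => Y (g + i)%N) l w) =
  eucl_dist (walk Y (g + l)%N w) (walk Y g w).
Proof.
rewrite eucl_distE; congr Num.sqrt; apply: eq_bigr => j _.
by rewrite !tnth_mktuple big_split_ord/= addrAC subrr add0r.
Qed.

Definition walk_point (n : nat) (w : T) (k : nat) : d.-tuple R :=
  [tuple tnth (walk Y k w) j / Num.sqrt n%:R | j < d].

Lemma eucl_dist_walk_point n w k l :
  eucl_dist (walk_point n w k) (walk_point n w l) =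
  eucl_dist (walk Y k w) (walk Y l w) / Num.sqrt n%:R.
Proof.
rewrite !eucl_distE -sqrtrV ?ler0n// -sqrtrM; last first.
  by apply: sumr_ge0 => j _; exact: sqr_ge0.
congr Num.sqrt; rewrite mulr_suml; apply: eq_bigr => j _.
have pE i : tnth (walk_point n w i) j = tnth (walk Y i w) j / Num.sqrt n%:R.
  exact: tnth_mktuple.
by rewrite !pE -mulrBl exprMn exprVn sqr_sqrtr ?ler0n.
Qed.

Variables (n h : nat) (c : R) (w : T).
Hypothesis h0 : (0 < h)%N.
Hypothesis c0 : 0 <= c.
(** Every base keeps the full horizon [n], even when [j * h + n] exceeds [n]: the sequence of
    increments is infinite, and one probability bound then serves all bases. *)
Hypothesis good : forall j, (j * h <= n)%N ->
  ~ deviation_event (fun i => Y (j * h + i)%N) n c w.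

Let good_dist j l : (j * h <= n)%N -> (l <= n)%N ->
  `|eucl_dist (walk Y (j * h + l)%N w) (walk Y (j * h)%N w) - Num.sqrt l%:R|
  <= Num.sqrt c.
Proof.
move=> jn ln; rewrite -eucl_norm_walk_shift.
set v := walk _ _ _.
rewrite [eucl_norm v](_ : _ = Num.sqrt (eucl_norm v ^+ 2)); last first.
  by rewrite sqrtr_sqr ger0_norm ?eucl_norm_ge0.
apply: le_trans (dist_sqrt_le _ _ _ (sqr_ge0 _) (ler0n _ _)) _.
rewrite ler_wsqrtr// leNgt; apply/negP => h1; apply: (good _ jn).
by exists l.
Qed.

(** Compare through the last base at or before [k], at distance [r < h] in time. The distances from
    this base to [k] and to [l] are each off by [Num.sqrt c], and the lag [r] costs [Num.sqrt h%:R]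
    twice; the four errors are each at most [Num.sqrt (h%:R + c)]. *)
Lemma walk_dist_sqrt k l : (k <= l)%N -> (l <= n)%N ->
  `|eucl_dist (walk Y k w) (walk Y l w) - Num.sqrt (l - k)%:R| <=
  4 * Num.sqrt (h%:R + c).
Proof.
move=> kl ln; pose j := (k %/ h)%N; pose r := (k %% h)%N.
have kE : k = (j * h + r)%N := divn_eq k h.
have rh : (r < h)%N by rewrite ltn_mod.
have jn : (j * h <= n)%N by lia.
have lE : l = (j * h + (r + (l - k)))%N by lia.
have rn : (r <= n)%N by lia.
have ln' : (r + (l - k) <= n)%N by lia.
have := good_dist j r jn rn; rewrite -kE.
have := good_dist j _ jn ln'; rewrite -lE.
have s1 : Num.sqrt c <= Num.sqrt (h%:R + c) by rewrite ler_wsqrtr// lerDr ler0n.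
have s2 : Num.sqrt h%:R <= Num.sqrt (h%:R + c) by rewrite ler_wsqrtr// lerDl.
have s3 : Num.sqrt (r + (l - k))%:R <= Num.sqrt r%:R + Num.sqrt (l - k)%:R :> R.
  by rewrite natrD sqrtD_le.
have s4 : Num.sqrt (l - k)%:R <= Num.sqrt (r + (l - k))%:R :> R.
  by rewrite ler_wsqrtr// ler_nat; lia.
have s5 : Num.sqrt r%:R <= Num.sqrt h%:R :> R by rewrite ler_wsqrtr// ler_nat ltnW.
have [_ _ sym tri] := @eucl_dist_metric R d.
have := tri (walk Y (j * h) w) (walk Y k w) (walk Y l w).
have := tri (walk Y k w) (walk Y l w) (walk Y (j * h) w).
rewrite (sym (walk Y l w) (walk Y k w)) (sym (walk Y (j * h) w) (walk Y l w)).
rewrite !ler_norml.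
have := sqrtr_ge0 c.
move=> ? ? ? /andP[? ?] /andP[? ?]; apply/andP; split; lra.
Qed.

Hypothesis n0 : (0 < n)%N.

(** The constant is 4 + 2: the second part pays for moving two parameters to the grid, each move
    costing [Num.sqrt n%:R^-1], which is small enough because [1 <= h]. *)
Lemma near_spiral_walk :
  near_spiral n (fun k l => eucl_dist (walk_point n w k) (walk_point n w l))
    (6 * Num.sqrt ((h%:R + c) / n%:R)).
Proof.
have nR : 0 < n%:R :> R by rewrite ltr0n.
pose x : R := (h%:R + c) / n%:R.
have scaled k l : (k <= l)%N -> (l <= n)%N ->
    `|eucl_dist (walk_point n w k) (walk_point n w l) -
      root_dist (k%:R / n%:R) (l%:R / n%:R)| <= 4 * Num.sqrt x.
  move=> kl ln; rewrite eucl_dist_walk_point /root_dist /x.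
  have -> : `|k%:R / n%:R - l%:R / n%:R| = (l - k)%:R / n%:R :> R.
    by rewrite -mulrBl -normrN -mulNr opprB -natrB// ger0_norm ?divr_ge0.
  rewrite sqrtrM ?ler0n// sqrtrM ?addr_ge0// sqrtrV ?ler0n// -mulrBl normrM mulrA.
  rewrite (ger0_norm (_ : 0 <= (Num.sqrt n%:R)^-1)) ?invr_ge0 ?sqrtr_ge0//.
  by rewrite ler_wpM2r ?invr_ge0 ?sqrtr_ge0// walk_dist_sqrt.
have scaled' k l : (k <= n)%N -> (l <= n)%N ->
    `|eucl_dist (walk_point n w k) (walk_point n w l) -
      root_dist (k%:R / n%:R) (l%:R / n%:R)| <= 4 * Num.sqrt x.
  move=> kn ln; have [kl|/ltnW lk] := leqP k l; first exact: scaled.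
  have [_ _ sE _] := @eucl_dist_metric R d; have [_ _ sR _] := root_dist_metric R.
  by rewrite sE sR; exact: scaled.
(* Each index is related to a whole interval around its grid point, so that every parameter in
   [0, 1] is reached; rounding [t * n%:R] down finds a partner. *)
exists (fun k t => [/\ (k <= n)%N, 0 <= t <= 1 & `|t - k%:R / n%:R| <= n%:R^-1]).
split.
- by move=> k t [].
- move=> k kn; exists (k%:R / n%:R); split=> //.
    by rewrite divr_ge0//= ler_pdivrMr// mul1r ler_nat.
  by rewrite subrr normr0 invr_ge0 ltW.
- move=> t t01; have /andP[t0 t1] := t01.
  have tn0 : 0 <= t * n%:R by exact: mulr_ge0 t0 (ltW nR).
  have /andP[h1 h2] := truncn_itv tn0.
  exists (Num.truncn (t * n%:R)); split=> //.
    rewrite -(ler_nat R); apply: le_trans h1 _.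
    by rewrite ler_piMl// ltW.
  rewrite ger0_norm ?subr_ge0 ?ler_pdivrMr//.
  rewrite lerBlDr -[X in X + _]mul1r -mulrDl ler_pdivlMr//.
  by rewrite -natr1 addrC in h2; exact: ltW.
- move=> k t l u [kn t01 kt] [ln u01 lu].
  have [z0 p0 s0 t0] := root_dist_metric R.
  have := scaled' k l kn ln.
  have hr : Num.sqrt n%:R^-1 <= Num.sqrt x.
    rewrite ler_wsqrtr// /x -[leLHS]mul1r ler_wpM2r ?invr_ge0 ?ler0n//.
    have : 1 <= h%:R :> R by rewrite ler1n.
    by have := c0; lra.
  have k1 : root_dist t (k%:R / n%:R) <= Num.sqrt n%:R^-1 by rewrite ler_wsqrtr.
  have l1 : root_dist u (l%:R / n%:R) <= Num.sqrt n%:R^-1 by rewrite ler_wsqrtr.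
  have := t0 (k%:R / n%:R) t u; have := t0 (l%:R / n%:R) (k%:R / n%:R) u.
  have := t0 t (k%:R / n%:R) (l%:R / n%:R); have := t0 u t (l%:R / n%:R).
  rewrite (s0 (l%:R / n%:R) u) (s0 (k%:R / n%:R) t) -/x.
  by rewrite !ler_norml => ? ? ? ? /andP[? ?]; apply/andP; split; lra.
Qed.
End WalkGeometry.

(** * Union bound over the bases *)

Section GHProbability.
Context {R : realType} {d : nat} {disp : measure_display}.
Context {Omega : measurableType disp}.
Variable P : probability Omega R.
Variables (sigma A e delta eps : R) (Y : nat -> Omega -> d.-tuple R) (n m : nat).

Lemma gh_probability_le :
  independent_seq P Y -> (forall i, step_moments P sigma A e (Y i)) ->
  0 <= A -> 0 <= sigma -> 0 < delta -> e <= delta -> (0 < n)%N -> (0 < m)%N ->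
  6 * Num.sqrt (m%:R^-1 + n%:R^-1 + 3 * delta) < 2 * eps ->
  (P [set w | (eps%:E < gromov_hausdorff_dist eucl_dist (walk_points Y n w)
                 L2_dist wiener_spiral)%E] <=
   (m%:R * (8 * sigma / delta ^+ 2 + 2 * A / (delta ^+ 2 * n%:R) + e / delta))%:E)%E.
Proof.
move=> iY hY A0 sigma0 delta0 e_delta n0 m0 small.
have mY i : measurable_fun setT (Y i) by exact: step_measurable (hY i).
have nR : 0 < n%:R :> R by rewrite ltr0n.
(* The successor makes [h] positive and gives [n < m * h], so at most [m] bases lie in [0, n], while
   h/n is still at most 1/m + 1/n. *)
pose h := (n %/ m).+1.
pose bad j := deviation_event (fun i => Y (j * h + i)%N) n (3 * delta * n%:R).
have mbad j : measurable (bad j) by apply: measurable_deviation_event.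
set E := [set w | _].
have sub : E `<=` \big[setU/set0]_(j < m) bad j.
  move=> w; rewrite /E/=; apply: contraPP => nbad; apply/negP; rewrite -leNgt ltW//.
  have c0 : 0 <= 3 * delta * n%:R by rewrite !mulr_ge0// ltW.
  have hn : (h%:R + 3 * delta * n%:R) / n%:R <= m%:R^-1 + n%:R^-1 + 3 * delta.
    rewrite mulrDl mulfK ?gt_eqF// lerD2r /h -natr1 mulrDl mul1r lerD2r.
    rewrite ler_pdivrMr// mulrC ler_pdivlMr ?ltr0n// -natrM ler_nat.
    exact: leq_divM.
  have sqrt_le : Num.sqrt ((h%:R + 3 * delta * n%:R) / n%:R) <=
    Num.sqrt (m%:R^-1 + n%:R^-1 + 3 * delta) by rewrite ler_wsqrtr.
  have sqrt_gt0 : 0 < Num.sqrt ((h%:R + 3 * delta * n%:R) / n%:R).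
    by rewrite sqrtr_gt0 divr_gt0// ltr_pwDl// ltr0n.
  apply: (@near_spiral_gh_lt _ _ n (walk_point Y n w)
    (3 * Num.sqrt ((h%:R + 3 * delta * n%:R) / n%:R))); [lra|lra|].
  rewrite mulrA (_ : 2 * 3 = 6); last by ring.
  apply: near_spiral_walk => // j jn badw; apply: nbad.
  have jm : (j < m)%N.
    have := ltn_ceil n m0; rewrite -/h => ?; nia.
  by rewrite -bigcup_mkord; exists j.
apply: (@le_trans _ _ (P (\big[setU/set0]_(j < m) bad j))).
  apply: le_measure => //; rewrite inE; first exact: measurable_gh_gt.
  exact: bigsetU_measurable.
apply: (le_trans (Boole_inequality P (fun j _ => mbad j))).
set b := (X in m%:R * X).
apply: (@le_trans _ _ (\sum_(j < m) b%:E)%E).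
  apply: lee_sum => j _; apply: deviation_probability => //.
  exact: independent_seq_shift.
by rewrite sumEFin sumr_const card_ord mulr_natl.
Qed.
End GHProbability.

(** * Transfer of the hypotheses to the independent copies *)

Section Copies.
Context {R : realType} {disp disp' : measure_display}.
Context {Omega : measurableType disp} {T : measurableType disp'}.
Variable P : probability Omega R.

Lemma mutually_independent_seq (Y : nat -> {RV P >-> T}) :
  mutually_independent Y -> independent_seq P (fun i => Y i : Omega -> T).
Proof.
move=> iY m B mB; pose J : {fset nat} := [fset i in iota 0 m]%fset.
have JE i : (i \in J) = (i < m)%N by rewrite !inE mem_iota.
have := iY J B mB.
have -> : [set` J] = `I_m by apply/seteqP; split=> i /=; rewrite JE.
move=> ->; rewrite -(big_mkord xpredT (fun i => P (Y i @^-1` B i))).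
apply: perm_big; apply: uniq_perm; rewrite ?fset_uniq ?iota_uniq// => i.
by rewrite JE mem_index_iota.
Qed.

Lemma has_mean_copy (U V : {RV P >-> T}) (f : T -> R) (m : R) :
  (forall B, measurable B -> distribution P U B = distribution P V B) ->
  measurable_fun setT f ->
  has_mean P (fun w => f (U w)) m -> has_mean P (fun w => f (V w)) m.
Proof.
move=> UV mf [fi fm].
have VE (g : T -> \bar R) : measurable_fun setT g -> (forall y, 0 <= g y)%E ->
    (\int[P]_w g (U w) = \int[P]_w g (V w))%E.
  move=> mg g0.
  have := ge0_integral_distribution U mg g0; rewrite /comp/= => <-.
  have := ge0_integral_distribution V mg g0; rewrite /comp/= => <-.
  by apply: eq_measure_integral => B mB _; exact: UV.
have mEf : measurable_fun setT (EFin \o f) by apply/measurable_EFinP.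
have Vi : P.-integrable setT (EFin \o (fun w => f (V w))).
  apply/integrableP; split; first exact: (measurableT_comp mEf (measurable_funPT V)).
  have /integrableP[_] := fi; rewrite /=.
  by rewrite (VE (fun y => `|(f y)%:E|%E))//; exact: measurableT_comp.
split=> //; rewrite -fm.
have := integral_distribution mEf fi; have := integral_distribution mEf Vi.
rewrite /comp/= => <- <-; apply: eq_measure_integral => B mB _; exact/esym/UV.
Qed.

End Copies.

Section CopiesMoments.
Context {R : realType} {d : nat} {disp : measure_display}.
Context {Omega : measurableType disp}.
Variable P : probability Omega R.

Lemma tail_sqr_indic (A : R) (Z : Omega -> d.-tuple R) w :
  eucl_norm (Z w) ^+ 2 * \1_[set w' | A < eucl_norm (Z w') ^+ 2] w =
  tail_sqr A (Z w).
Proof.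
rewrite indicE /tail_sqr; case: ifPn => h; first by rewrite mem_set ?mulr1.
by rewrite memNset ?mulr0//; exact/negP.
Qed.

(** The moment hypotheses are values of integrals, stated partly for [X] and partly for [Y].
    Integrability is obtained by domination: a coordinate by 1 plus the squared norm, a product of
    two coordinates by the squared norm. Equality of laws then moves what is known for [X] or [Y 0]
    to every copy. *)
Lemma copies_step_moments (X : {RV P >-> d.-tuple R})
    (Y : nat -> {RV P >-> d.-tuple R}) (A sigma : R) :
  independent_copies X Y ->
  (forall k : 'I_d, 'E_P[fun w => tnth (X w) k] = 0)%E ->
  ('E_P[fun w => (eucl_norm (X w) ^+ 2)%R] = 1)%E ->
  (forall (i : nat) (j k : 'I_d), j != k ->
    'E_P[fun w => (tnth (Y i w) j * tnth (Y i w) k)%R] = 0)%E ->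
  (forall k : 'I_d, 'E_P[fun w => (tnth (Y 0%N w) k ^+ 2)%R] <= sigma%:E)%E ->
  exists2 e, ('E_P[fun w => (eucl_norm (X w) ^+ 2
      * \1_[set w' | A < eucl_norm (X w') ^+ 2] w)%R] = e%:E)%E &
    forall i, step_moments P sigma A e (Y i).
Proof.
move=> [_ XY] EX EN EC EV; rewrite !unlock in EN *.
have mt (j : 'I_d) : measurable_fun setT (fun z : d.-tuple R => tnth z j).
  exact: measurable_tnth.
have mn : measurable_fun setT (fun z : d.-tuple R => eucl_norm z ^+ 2).
  exact: measurable_eucl_norm2.
have mta : measurable_fun setT (fun z : d.-tuple R => tail_sqr A z).
  exact: measurable_tail_sqr.
have mc (f : d.-tuple R -> R) (Z : {RV P >-> d.-tuple R}) :
    measurable_fun setT f -> measurable_fun setT (fun w => f (Z w)).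
  by move=> mf; exact: (measurableT_comp mf (measurable_funPT Z)).
have XN : has_mean P (fun w => eucl_norm (X w) ^+ 2) 1.
  by apply: has_mean_ge0 => //; [exact: mc mn|move=> w; exact: sqr_ge0].
have sq1 (x : R) : `|x| <= 1 + x ^+ 2.
  by have := sqr_ge0 (`|x| - 1); rewrite -[x ^+ 2]real_normK ?num_real//; nra.
have XY' i B : measurable B -> distribution P X B = distribution P (Y i) B.
  by move=> mB; rewrite XY.
have YN i : has_mean P (fun w => eucl_norm (Y i w) ^+ 2) 1.
  exact: has_mean_copy (XY' i) mn XN.
have [e _ Xe] : exists2 e, 0 <= e <= 1 & has_mean P (fun w => tail_sqr A (X w)) e.
  apply: has_mean_dominated XN; first exact: mc mta.
  move=> w; rewrite tail_sqr_ge0 /tail_sqr/=; case: ifP => // _; exact: sqr_ge0.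
exists e.
  rewrite -Xe.2; apply: eq_integral => w _; congr EFin; exact: tail_sqr_indic.
move=> i; split.
- exact: measurable_funPT.
- move=> j; apply: (has_mean_copy P X (Y i) (fun z => tnth z j)) => //; first exact: XY'.
  apply: (has_mean_normr_le P _ (fun w => 1 + eucl_norm (X w) ^+ 2) (1 + 1)).
  + exact: mc (mt j).
  + move=> w; apply: le_trans (sq1 _) _; rewrite lerD2l; exact: sqr_tnth_le.
  + exact: has_meanD (has_mean_cst _ _) XN.
  + by have := EX j; rewrite unlock.
- move=> j k jk; apply: (has_mean_normr_le P _ (fun w => eucl_norm (Y i w) ^+ 2) 1).
  + by apply: measurable_funM; [exact: mc (mt j)|exact: mc (mt k)].
  + move=> w; rewrite normrM.
    have := sqr_tnth_le (Y i w) j; have := sqr_tnth_le (Y i w) k.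
    have := sqr_ge0 (`|tnth (Y i w) j| - `|tnth (Y i w) k|).
    rewrite -[tnth _ j ^+ 2]real_normK ?num_real// -[tnth _ k ^+ 2]real_normK ?num_real//.
    nra.
  + exact: YN.
  + by have := EC i j k jk; rewrite unlock.
- move=> j.
  have [v _ hv] : exists2 v, 0 <= v <= 1 & has_mean P (fun w => tnth (Y 0%N w) j ^+ 2) v.
    apply: has_mean_dominated (YN 0%N); first by apply: measurable_funX; exact: mc (mt j).
    by move=> w; rewrite sqr_ge0 sqr_tnth_le.
  exists v; first by have := EV j; rewrite unlock hv.2 lee_fin.
  apply: (has_mean_copy P (Y 0%N) (Y i) (fun z => tnth z j ^+ 2)) => //.
    by move=> B mB; rewrite !XY.
  exact: measurable_funX.
- exact: YN.
- exact: has_mean_copy (XY' i) mta Xe.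
Qed.

End CopiesMoments.

Lemma cvge0_lt {R : realType} {T : Type} {F : set_system T} {FF : Filter F}
    (f : T -> \bar R) (c : R) : f @ F --> 0%E -> 0 < c ->
  \forall x \near F, (f x < c%:E)%E.
Proof.
move=> /fine_cvgP[ffin fcvg] c0.
near=> x; rewrite -[f x]fineK; last by near: x.
by rewrite lte_fin; near: x; apply: (cvgr_lt 0 fcvg).
Unshelve. all: by end_near. Qed.

Theorem theorem2p4 (R : realType)
    (disp : nat -> measure_display)
    (Omega : forall d : nat, measurableType (disp d))
    (P : forall d : nat, probability (Omega d) R)
    (X : forall d : nat, {RV (P d) >-> d.-tuple R})
    (Xi : forall d : nat, nat -> {RV (P d) >-> d.-tuple R})
    (n : nat -> nat)
    (hcopies : forall d : nat, (0 < d)%N -> independent_copies (X d) (Xi d))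
    (ha_mean : forall d : nat, (0 < d)%N -> forall k : 'I_d,
       ('E_(P d)[fun w => tnth (X d w) k] = 0)%E)
    (ha_norm : forall d : nat, (0 < d)%N ->
       ('E_(P d)[fun w => (eucl_norm (X d w) ^+ 2)%R] = 1)%E)
    (hb : forall d : nat, (0 < d)%N -> forall (i : nat) (j k : 'I_d), j != k ->
       ('E_(P d)[fun w => (tnth (Xi d i w) j * tnth (Xi d i w) k)%R] = 0)%E)
    (hc : ereal_sup
            [set 'E_(P d)[fun w => (eucl_norm (X d w) ^+ 2
                   * \1_[set w' | A < eucl_norm (X d w') ^+ 2] w)%R]%E
            | d in [set d : nat | (0 < d)%N]]
          @[A --> +oo%R] --> 0%E)
    (hd : (\big[maxe/-oo]_(k < d) 'E_(P d)[fun w => (tnth (Xi d 0%N w) k ^+ 2)%R])%E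
          @[d --> \oo] --> 0%E)
    (hn_pos : forall d : nat, (0 < d)%N -> (0 < n d)%N)
    (hn_lim : n d @[d --> \oo] --> \oo) :
  forall eps : R, 0 < eps ->
    P d [set w | (eps%:E < gromov_hausdorff_dist
                             eucl_dist (walk_points (Xi d) (n d) w)
                             L2_dist wiener_spiral)%E]
    @[d --> \oo] --> 0%E.
Proof.
move=> eps eps0.
pose S d := [set w | (eps%:E < gromov_hausdorff_dist eucl_dist
  (walk_points (Xi d) (n d) w) L2_dist wiener_spiral)%E].
have mS d : measurable (S d).
  by apply: measurable_gh_gt => i; exact: measurable_funPT.
suff small (eta : R) : 0 < eta -> \forall d \near \oo, (P d (S d) <= eta%:E)%E.
  apply/fine_cvgP; split.
    by apply: nearW => d; rewrite fin_num_measure.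
  apply/cvgr0Pnorm_le => eta eta0; have := small _ eta0.
  apply: filterS => d le_eta /=.
  by rewrite ger0_norm ?fine_ge0// -lee_fin fineK// fin_num_measure.
move=> eta0.
(* Since 6 sqrt(x) = 3 eps / 2 < 2 eps, it is enough to keep 1/m, 1/n and 3 delta below x/4 each.
   [m], [A] and [sigma] are all fixed before [d], and the probability bound is split into three
   parts of size eta/3. *)
pose x := (eps / 4) ^+ 2; have x0 : 0 < x by rewrite exprn_gt0// divr_gt0.
pose delta := x / 12; have delta0 : 0 < delta by rewrite divr_gt0.
have x40 : 0 < x / 4 by rewrite divr_gt0.
have [m0 _ /(_ m0 (leqnn _))/= hm] := near_infty_natSinv_lt (PosNum x40).
pose m := m0.+1; have mR : 0 < m%:R :> R by rewrite ltr0n.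
(* A tail mean below the first entry absorbs the deterministic term; below the second, the tail part
   of the union bound is at most eta/3. *)
pose c := Order.min delta (eta * delta / (3 * m%:R)).
have c0 : 0 < c.
  by rewrite lt_min delta0/= divr_gt0 ?mulr_gt0.
have [A [A0 hA]] : exists A : R, 0 <= A /\ (ereal_sup
   [set 'E_(P d)[fun w => (eucl_norm (X d w) ^+ 2
      * \1_[set w' | A < eucl_norm (X d w') ^+ 2] w)%R]%E
   | d in [set d : nat | (0 < d)%N]] < c%:E)%E.
  have := filter_ex (filterI (nbhs_pinfty_ge (num_real (0 : R))) (cvge0_lt _ _ hc c0)).
  by move=> [A [A0 hA]]; exists A.
(* Chosen so that [m%:R * (8 * sigma / delta ^+ 2)] equals eta/3. *)
pose sigma := eta * delta ^+ 2 / (24 * m%:R).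
have sigma0 : 0 < sigma by rewrite divr_gt0 ?mulr_gt0// exprn_gt0.
(* The first summand forces 1/n below x/4, the second bounds the truncation part by eta/3, and the 1
   makes the first bound strict. *)
pose K := (x / 4)^-1 + 6 * A * m%:R / (delta ^+ 2 * eta) + 1.
have nK := hn_lim _ (nbhs_infty_ger K).
have dV := cvge0_lt _ _ hd sigma0.
near=> d.
have d0 : (0 < d)%N by near: d; exists 1%N.
have hV k : ('E_(P d)[fun w => (tnth (Xi d 0%N w) k ^+ 2)%R] <= sigma%:E)%E.
  have hmax : (\big[maxe/-oo]_(k < d)
      'E_(P d)[fun w => (tnth (Xi d 0%N w) k ^+ 2)%R] < sigma%:E)%E.
    by near: d; exact: dV.
  apply: le_trans (ltW hmax).
  exact: (le_bigmax -oo%E (fun k => 'E_(P d)[fun w => (tnth (Xi d 0%N w) k ^+ 2)%R]%E) k).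
have hK : K <= (n d)%:R by near: d; exact: nK.
have n0 := hn_pos _ d0; have nR : 0 < (n d)%:R :> R by rewrite ltr0n.
have [e Ee hY] := copies_step_moments (P d) (X d) (Xi d) A sigma (hcopies _ d0)
  (ha_mean _ d0) (ha_norm _ d0) (hb _ d0) hV.
have ec : e < c.
  by rewrite -lte_fin -Ee; apply: le_lt_trans hA; apply: ereal_sup_ubound; exists d.
have [e1 e2] : e <= delta /\ e <= eta * delta / (3 * m%:R).
  by move: ec; rewrite lt_min => /andP[/ltW ? /ltW ?].
have B0 : 0 <= 6 * A * m%:R / (delta ^+ 2 * eta).
  by rewrite divr_ge0 ?mulr_ge0// ?sqr_ge0// ltW.
have hn1 : (n d)%:R^-1 < x / 4.
  rewrite -[ltRHS]invrK ltf_pV2 ?posrE ?invr_gt0//.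
  by apply: lt_le_trans hK; rewrite /K; lra.
apply: le_trans (gh_probability_le (P d) sigma A e delta eps (Xi d) (n d) m _ hY
  A0 (ltW sigma0) delta0 e1 n0 _ _) _ => //.
- by apply: mutually_independent_seq; case: (hcopies _ d0).
- have : Num.sqrt (m%:R^-1 + (n d)%:R^-1 + 3 * delta) <= eps / 4.
    have q0 : 0 <= eps / 4 by rewrite divr_ge0// ltW.
    rewrite -[leRHS](ger0_norm q0) -sqrtr_sqr ler_wsqrtr// -/x.
    have dE : 3 * delta = x / 4 by rewrite /delta; field.
    rewrite dE; have hx : x / 4 + x / 4 + x / 4 <= x by move: x0; lra.
    apply: le_trans hx; rewrite lerD2r lerD// ltW//.
  lra.
rewrite lee_fin.
have t1 : m%:R * (8 * sigma / delta ^+ 2) = eta / 3.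
  by rewrite /sigma; field; rewrite !gt_eqF.
have t2 : m%:R * (2 * A / (delta ^+ 2 * (n d)%:R)) <= eta / 3.
  have -> : m%:R * (2 * A / (delta ^+ 2 * (n d)%:R)) =
      6 * A * m%:R / (delta ^+ 2 * eta) * (eta / 3) / (n d)%:R.
    by field; rewrite !gt_eqF.
  have q0 : 0 <= eta / 3 by rewrite divr_ge0// ltW.
  rewrite ler_pdivrMr// mulrC ler_wpM2l//.
  apply: le_trans hK; rewrite /K.
  have : 0 < (x / 4)^-1 by rewrite invr_gt0.
  lra.
have t3 : m%:R * (e / delta) <= eta / 3.
  have -> : eta / 3 = m%:R * (eta * delta / (3 * m%:R) / delta).
    by field; rewrite !gt_eqF.
  apply: ler_wpM2l; first exact: ltW.
  by apply: ler_wpM2r => //; rewrite invr_ge0 ltW.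
rewrite !mulrDr; lra.
Unshelve. all: by end_near. Qed.
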